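(* Let $k_\varepsilon$ be a symmetric $2\times2$ matrix-valued coefficient on $\Omega$ that satisfies the boundedness and coercivity conditions: there are $c_1,c_2>0$ such that, for all $\xi\in\mathbb R^2$, $k_\varepsilon(x)\xi\cdot\xi\ge c_1|\xi|^2$ and $|k_\varepsilon(x)\xi|\le c_2|\xi|$ for a.e. $x\in\Omega$. For any fixed $\varepsilon>0$, $H>0$ and $h>0$, and for any constants $c_+>c_->0$, the optimization problem $$I_{\varepsilon,H,h}=\inf\{J_{\varepsilon,H,h}(\overline k),\ \overline k\in\mathcal M(c_-,c_+)\}$$ has at least one minimizer $\overline k^{\rm opt}_\varepsilon(H,h)\in\mathcal M(c_-,c_+)$.
   Context: **Geometry.** Fix $0<L_f<L_c<L$ and set, in $\mathbb R^2$, $\Omega=(-L,L)^2$, $D_f=(-L_f,L_f)^2$, $D_c=(-L_c,L_c)^2\setminus[-L_f,L_f]^2$, $D=(-L,L)^2\setminus[-L_c,L_c]^2$. Let $\Gamma=\partial\Omega$ (exterior boundary of $D$), $\Gamma_f=\partial D_f$, $\Gamma_c=\partial\big((-L_c,L_c)^2\big)$, and let $n_{\Gamma_c}$, $n_{\Gamma_f}$ be the unit normals on $\Gamma_c$, $\Gamma_f$ outward to $D_c$. The notation $H^1(D\cup D_c)$ means $H^1(D\cup D_c\cup\Gamma_c)$ and $H^1(D_c\cup D_f)$ means $H^1(D_c\cup D_f\cup\Gamma_f)$ (no jump across the interface). $(e_1,e_2)$ is the canonical basis. **Admissible matrices.** $\mathcal M(c_-,c_+)$ is the set of symmetric real $2\times2$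 matrices $\overline k$ with $c_-\le\overline k\le c_+$ in the sense of symmetric matrices. **Bilinear forms.** For a constant symmetric matrix $\overline k$ and a matrix field $k$: $\overline A_{\overline k}(\overline u,\overline v)=\int_D\overline k\nabla\overline u\cdot\nabla\overline v+\frac12\int_{D_c}\overline k\nabla\overline u\cdot\nabla\overline v$; $\check A_k(\check u,\check v)=\frac12\int_{D_c}k\nabla\check u\cdot\nabla\check v+\int_{D_f}k\nabla\check u\cdot\nabla\check v$; $\mathcal C(u,\phi)=\int_{D_c}\nabla u\cdot\nabla\phi+u\phi$. **Discretization.** $\mathcal T_H$ is a conforming triangular mesh (size $H$) of $D\cup D_c$, matching on $\Gamma_c$; $\mathcal T_h$ is a conforming triangular mesh (size $h$) of $D_c\cup D_f$, matching on $\Gamma_f$, which in $D_c$ is a submesh of $\mathcal T_H$. $V_H$ (resp. $V_h$, $W_H$, $W_h$) is the space of functions of $H^1(D\cup D_c)$ (resp. $H^1(D_c\cup D_f)$, $H^1(D_c)$, $H^1(D_c)$) that are piecewise affine on $\mathcal T_H$ (resp. $\mathcal T_h$, $\mathcal T_H$, $\mathcal T_h$). $V_H^{\rm DirBC}=\{v\in V_H: v(x)=x_1\text{ on }\Gamma\}$, $V_H^0=\{v\in V_H: v=0\text{ on }\Gamma\}$. For $j=1,2$ let $\psi_{0,j}^h\in W_h$ be the solution of $\mathcal C(\psi_{0,j}^h,\phi^h)=\frac12\int_{\Gamma_c}(e_j\cdot n_{\Gamma_c})\phi^h-\frac12\int_{\Gamma_f}(e_j\cdot n_{\Gamma_f})\phi^h$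 for all $\phi^h\in W_h$, and $W_{H,h}^{\rm enrich}=W_H+\mathrm{Span}\,\psi_{0,1}^h+\mathrm{Span}\,\psi_{0,2}^h$. **Coupled problem and cost function.** For a symmetric positive definite matrix $\overline k$, let $(\overline u^H_{\overline k,k_\varepsilon},\check u^h,\psi^H)\in V_H^{\rm DirBC}\times V_h\times W_{H,h}^{\rm enrich}$ be the unique solution of $\overline A_{\overline k}(\overline u^H_{\overline k,k_\varepsilon},\overline v^H)+\mathcal C(\overline v^H,\psi^H)=0$ for all $\overline v^H\in V_H^0$; $\check A_{k_\varepsilon}(\check u^h,\check v^h)-\mathcal C(\check v^h,\psi^H)=0$ for all $\check v^h\in V_h$; $\mathcal C(\overline u^H_{\overline k,k_\varepsilon}-\check u^h,\phi^H)=0$ for all $\phi^H\in W_{H,h}^{\rm enrich}$. Set $J_{\varepsilon,H,h}(\overline k)=\int_{D\cup D_c}|\nabla\overline u^H_{\overline k,k_\varepsilon}-e_1|^2$. *)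

(* Defs.v *)
From HB Require Import structures.
From mathcomp Require Import all_boot all_order all_algebra.
From mathcomp Require Import all_classical all_reals all_analysis.

Set Implicit Arguments.
Unset Strict Implicit.
Unset Printing Implicit Defensive.

Import Order.TTheory GRing.Theory Num.Theory.
Import numFieldNormedType.Exports.

Local Open Scope classical_set_scope.
Local Open Scope ring_scope.

(* Points and vectors of the plane are pairs, because the
   two-dimensional Lebesgue measure lives on [R * R].  The library norm there
   is the sup norm, so the Euclidean structure is [dot] and [enorm]. *)
Notation leb R := (@lebesgue_measure R).
Notation leb2 R := (@lebesgue_measure R \x @lebesgue_measure R)%E.

Section Plane.
Variable R : realType.
Local Notation R2 := (R * R)%type.
Implicit Types (x v w : R2) (A B : 'M[R]_2).

Definition e1 : R2 := (1, 0).
Definition e2 : R2 := (0, 1).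
Definition ebasis (j : 'I_2) : R2 := if j == 0 then e1 else e2.

Definition dot v w : R := v.1 * w.1 + v.2 * w.2.
Definition enorm v : R := Num.sqrt (dot v v).

Definition mxact A v : R2 :=
  (A 0 0 * v.1 + A 0 1 * v.2, A 1 0 * v.1 + A 1 1 * v.2).

Definition symmetric_mx A : Prop := A^T = A.

Definition loewner_le A B : Prop :=
  forall v, dot (mxact A v) v <= dot (mxact B v) v.

Definition admissible (cm cp : R) : set 'M[R]_2 :=
  [set A | [/\ symmetric_mx A, loewner_le cm%:M A & loewner_le A cp%:M]].

Definition osquare (a : R) : set R2 := `](- a), a[ `*` `](- a), a[.
Definition csquare (a : R) : set R2 := `[(- a), a] `*` `[(- a), a].

Definition frontier (E : set R2) : set R2 := closure E `\` interior E.

(* Integral over the boundary of the square of half-side [a] of [f x n], with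
   [n] the unit normal at [x] pointing out of the square. *)
Definition square_bdry_int (a : R) (f : R2 -> R2 -> R) : R :=
  \int[leb R]_(s in `[(- a), a])
    (f (a, s) e1 + f (- a, s) (- e1) + f (s, a) e2 + f (s, - a) (- e2)).

End Plane.

Arguments e1 {R}.
Arguments e2 {R}.

Section Sobolev.
Variable R : realType.
Local Notation R2 := (R * R)%type.
Implicit Types (E : set R2) (u v f : R2 -> R) (g : R2 -> R2).

Definition L2 E f : Prop :=
  measurable_fun E f /\ (leb2 R).-integrable E (fun x => ((f x) ^+ 2)%:E).

(* C^1 functions with compact support in E *)
Definition test_fun E (phi : R2 -> R) : Prop :=
  [/\ forall x, differentiable phi x,
      forall v : R2, continuous (fun x => 'D_v phi x) &
      exists K : set R2,
        [/\ compact K, K `<=` E & forall x, ~ K x -> phi x = 0]].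

(* [g] represents the distributional gradient of [u] on the open set [E] and
   is square integrable there. *)
Definition weak_gradient E u g : Prop :=
  [/\ L2 E (fun x => (g x).1), L2 E (fun x => (g x).2) &
      forall phi, test_fun E phi ->
        (\int[leb2 R]_(x in E) (u x * 'D_e1 phi x))
          = - (\int[leb2 R]_(x in E) ((g x).1 * phi x)) /\
        (\int[leb2 R]_(x in E) (u x * 'D_e2 phi x))
          = - (\int[leb2 R]_(x in E) ((g x).2 * phi x))].

Definition H1 E : set (R2 -> R) :=
  [set u | L2 E u /\ exists g, weak_gradient E u g].

(* A representative of the weak gradient on the open set [E], unique almost
   everywhere on [E].  If [u] is in [H1 U] with [E] an open subset of [U], it
   agrees almost everywhere on [E] with the weak gradient of [u] on [U]. *)
Definition grad E u : R2 -> R2 :=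
  xget (fun=> (0, 0)) [set g | weak_gradient E u g].

(* \int_E (k grad u) . grad v *)
Definition stiffness (k : R2 -> 'M[R]_2) E u v : R :=
  \int[leb2 R]_(x in E) dot (mxact (k x) (grad E u x)) (grad E v x).

(* The H^1 inner product on E *)
Definition H1_dot E u v : R :=
  \int[leb2 R]_(x in E) (dot (grad E u x) (grad E v x) + u x * v x).

(* Boundedness and coercivity, with [xi] quantified before the null set. *)
Definition coefficient E (k : R2 -> 'M[R]_2) : Prop :=
  [/\ forall i j, measurable_fun E (fun x => k x i j),
      {ae leb2 R, forall x, E x -> symmetric_mx (k x)} &
      exists c1 c2 : R, [/\ 0 < c1, 0 < c2 &
        forall xi : R2, {ae leb2 R, forall x, E x ->
          c1 * enorm xi ^+ 2 <= dot (mxact (k x) xi) xi /\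
          enorm (mxact (k x) xi) <= c2 * enorm xi}]].

End Sobolev.

Section Mesh.
Variable R : realType.
Local Notation R2 := (R * R)%type.
Local Notation triangle := {ffun 'I_3 -> R2}.
Implicit Types (t : triangle) (T : seq triangle) (S : {set 'I_3}).

(* Convex hull of the vertices of [t] with index in [S]; empty if [S] is. *)
Definition face t S : set R2 :=
  [set x | exists w : 'I_3 -> R,
     [/\ forall i, 0 <= w i, forall i, i \notin S -> w i = 0,
         \sum_i w i = 1,
         x.1 = \sum_i w i * (t i).1 & x.2 = \sum_i w i * (t i).2]].

Definition cell t : set R2 := face t [set: 'I_3]%SET.

Definition nondegenerate_tri t : Prop :=
  let p := t 0 in let q := t 1 in let r := t 2 in
  (q.1 - p.1) * (r.2 - p.2) - (q.2 - p.2) * (r.1 - p.1) != 0.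

(* Distinct triangles meet in nothing, a common vertex or a common edge. *)
Definition conforming T : Prop :=
  forall t t', t \in T -> t' \in T -> t != t' ->
    exists S S' : {set 'I_3},
      [/\ S \proper [set: 'I_3]%SET, S' \proper [set: 'I_3]%SET,
          cell t `&` cell t' = face t S & cell t `&` cell t' = face t' S'].

(* Conforming mesh of the two adjacent open sets [A] and [B], matching on
   their interface: no triangle straddles it. *)
Definition mesh (A B : set R2) T : Prop :=
  [/\ forall t, t \in T -> nondegenerate_tri t,
      \bigcup_(t in [set` T]) cell t = closure (A `|` B),
      forall t, t \in T -> cell t `<=` closure A \/ cell t `<=` closure B &
      conforming T].

Definition diameter (E : set R2) : R :=
  sup [set d | exists x y, [/\ E x, E y & d = enorm (x - y)]].

Definition mesh_size T : R := \big[Num.max/0]_(t <- T) diameter (cell t).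

(* In [E], the mesh [Th] refines [TH]. *)
Definition submesh_in (E : set R2) (Th TH : seq triangle) : Prop :=
  forall t, t \in Th -> cell t `<=` closure E ->
    exists2 t', t' \in TH & cell t `<=` cell t'.

Definition affine_on (E : set R2) (v : R2 -> R) : Prop :=
  exists (a : R2) (b : R), forall x, E x -> v x = dot a x + b.

(* Functions of [H1 U] that are affine on every (closed) triangle of [T]
   lying in the closure of [U].  These are pointwise representatives: the
   values on the boundary of [U] are those of the affine pieces. *)
Definition fem (U : set R2) T : set (R2 -> R) :=
  [set v | H1 U v /\
     forall t, t \in T -> cell t `<=` closure U -> affine_on (cell t) v].

End Mesh.

Section Coupling.
Variable R : realType.
Local Notation R2 := (R * R)%type.
Variables (Lf Lc L : R).

Definition Omega : set R2 := osquare L.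
Definition Df : set R2 := osquare Lf.
Definition Dc : set R2 := osquare Lc `\` csquare Lf.
Definition D : set R2 := osquare L `\` csquare Lc.
Definition Gamma : set R2 := frontier Omega.
Definition Gammaf : set R2 := frontier Df.
Definition Gammac : set R2 := frontier (osquare Lc).

Variables (TH Th : seq {ffun 'I_3 -> R2}).

Definition VH : set (R2 -> R) := fem (D `|` Dc `|` Gammac) TH.
Definition Vh : set (R2 -> R) := fem (Dc `|` Df `|` Gammaf) Th.
Definition WH : set (R2 -> R) := fem Dc TH.
Definition Wh : set (R2 -> R) := fem Dc Th.

Definition VH_DirBC : set (R2 -> R) :=
  [set v | VH v /\ forall x, Gamma x -> v x = x.1].
Definition VH_0 : set (R2 -> R) :=
  [set v | VH v /\ forall x, Gamma x -> v x = 0].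

Definition Abar (kbar : 'M[R]_2) (u v : R2 -> R) : R :=
  stiffness (fun=> kbar) D u v + 2^-1 * stiffness (fun=> kbar) Dc u v.

Definition Acheck (k : R2 -> 'M[R]_2) (u v : R2 -> R) : R :=
  2^-1 * stiffness k Dc u v + stiffness k Df u v.

Definition C (u phi : R2 -> R) : R := H1_dot Dc u phi.

(* Both normals point out of [Dc]: away from the origin on [Gammac], towards
   it on [Gammaf], whence the sign of [n] in the second integral. *)
Definition is_psi0 (j : 'I_2) (psi : R2 -> R) : Prop :=
  Wh psi /\ forall phi, Wh phi ->
    C psi phi =
      2^-1 * square_bdry_int Lc (fun x n => dot (ebasis R j) n * phi x)
      - 2^-1 * square_bdry_int Lf (fun x n => dot (ebasis R j) (- n) * phi x).

Definition psi0 (j : 'I_2) : R2 -> R := xget (fun=> 0) [set psi | is_psi0 j psi].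

Definition W_enrich : set (R2 -> R) :=
  [set w | exists w0 (a : 'I_2 -> R),
     WH w0 /\ w = fun x => w0 x + \sum_j a j * psi0 j x].

Variable (keps : R2 -> 'M[R]_2).

Definition is_coupled_solution (kbar : 'M[R]_2)
    (s : (R2 -> R) * (R2 -> R) * (R2 -> R)) : Prop :=
  let: (u, uc, psi) := s in
  [/\ VH_DirBC u /\ Vh uc /\ W_enrich psi,
      forall v, VH_0 v -> Abar kbar u v + C v psi = 0,
      forall v, Vh v -> Acheck keps uc v - C v psi = 0 &
      forall phi, W_enrich phi -> C (fun x => u x - uc x) phi = 0].

(* The coupled solution is unique up to the values taken outside the closures
   of the domains, which do not affect [cost]. *)
Definition coupled_solution (kbar : 'M[R]_2)
    : (R2 -> R) * (R2 -> R) * (R2 -> R) :=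
  xget (fun=> 0, fun=> 0, fun=> 0) [set s | is_coupled_solution kbar s].

Definition ubar (kbar : 'M[R]_2) : R2 -> R := (coupled_solution kbar).1.1.

Definition cost (kbar : 'M[R]_2) : R :=
  \int[leb2 R]_(x in D `|` Dc)
    enorm (grad (D `|` Dc) (ubar kbar) x - e1) ^+ 2.

End Coupling.

(* [a] is admissible, realizes the infimum of [f] over [A], and that infimum is
   a genuine lower bound ([inf] of an unbounded set would be junk). *)
Definition minimizer (R : realType) (T : Type) (f : T -> R) (A : set T) (a : T)
    : Prop :=
  [/\ A a, f a = inf (f @` A) & forall b, A b -> f a <= f b].

(* Main.v *)
Require Import Defs.
From HB Require Import structures.
From mathcomp Require Import all_boot all_order all_algebra.
From mathcomp Require Import all_classical all_reals all_analysis.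
From mathcomp Require Import measurable_realfun ring lra.

(* The cost only sees grad ubar, so no uniqueness of the coupled solution and no
   Poincare inequality is needed.  Weak gradients are unique almost everywhere
   (test functions approximate indicators of rectangles), hence the energies
   are genuine symmetric bilinear forms on H^1.  A finite element function is
   determined by its values at the mesh vertices, so the coupled problem is a
   symmetric finite linear system; by semidefiniteness its right-hand side
   vanishes on the kernel, and it is solvable for every admissible matrix as
   soon as the affine constraint set is nonempty.  If that set is empty, no
   matrix gives a solution, the cost is evaluated at the default value [xget]
   returns, and it is constant.  Otherwise, testing the problems for two
   matrices with the difference of their solutions bounds its energy by the
   square of the distance between the matrices; the cost is therefore
   continuous on the compact set of admissible matrices. *)

Set Implicit Arguments.
Unset Strict Implicit.
Unset Printing Implicit Defensive.
Import Order.TTheory GRing.Theory Num.Theory.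
Import numFieldNormedType.Exports.
Local Open Scope classical_set_scope.
Local Open Scope ring_scope.

(** * Rectangles in the plane *)

Section Rectangles.
Variable R : realType.
Local Notation R2 := (R * R)%type.

(** The obstacle is [grad]: an [xget] choice among weak gradients, made separately on each domain,
    about which nothing is known pointwise. Linearity, restriction and vanishing of gradients are
    almost everywhere statements, and each transfer to an integral also requires measurability. The
    saddle problem is solvable because a kernel element has zero energy and hence, by
    Cauchy-Schwarz, zero energy product with everything, including the lifting of the boundary data.
    Vertex values serve only as a linear map into a finite-dimensional space whose kernel the forms
    do not see. When two matrices differ by d, the difference of the solutions has energy of order
    d^2; Young's inequality with weight d splits the cross term of the cost and leaves an error of
    order d, with a constant that involves only one of the two solutions. *)

Definition orect (a b c d : R) : set R2 := `]a, b[ `*` `]c, d[.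
Definition crect (a b c d : R) : set R2 := `[a, b] `*` `[c, d].

Definition orects : set (set R2) :=
  [set A `*` B | A in @RGenOpens.G R & B in @RGenOpens.G R].

(** Supplies the generating pi-system for the Dynkin argument behind the fundamental lemma. *)
Lemma measurable_orects : @measurable _ R2 = <<s orects >>.
Proof.
rewrite eqEsubset; split; last first.
  apply: smallest_sub; first exact: sigma_algebra_measurable.
  move=> _ [A [a [b ->]] [B [c [d ->]] <-]].
  by apply: measurableX; exact: measurable_itv.
(* The product sigma-algebra is generated by the two projections, so these have to be measurable for
   the rectangles. A strip is not a bounded rectangle, but it is exhausted by those of height 2n. *)
have m1 : measurable_fun setT (fst : g_sigma_algebraType orects -> R).
  apply: (measurability _ (RGenOpens.measurableE R)).
  move=> _ [_ [a [b ->]] <-]; rewrite setTI.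
  rewrite [X in measurable X](_ : _ =
      \bigcup_n (`]a, b[ `*` `](- n%:R), n%:R[)).
    apply: bigcup_measurable => n _; apply: sub_sigma_algebra.
    exists `]a, b[%classic; first by exists a, b.
    by exists `](- n%:R), n%:R[%classic; first by exists (- n%:R), n%:R.
  apply/seteqP; split=> [[x y] /= xab|[x y] [n _ []//]].
  exists (Num.trunc `|y|).+1 => //; split => //=.
  by rewrite in_itv/= -ltr_norml truncnS_gt.
have m2 : measurable_fun setT (snd : g_sigma_algebraType orects -> R).
  apply: (measurability _ (RGenOpens.measurableE R)).
  move=> _ [_ [a [b ->]] <-]; rewrite setTI.
  rewrite [X in measurable X](_ : _ =
      \bigcup_n (`](- n%:R), n%:R[ `*` `]a, b[)).
    apply: bigcup_measurable => n _; apply: sub_sigma_algebra.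
    exists `](- n%:R), n%:R[%classic; first by exists (- n%:R), n%:R.
    by exists `]a, b[%classic; first by exists a, b.
  apply/seteqP; split=> [[x y] /= xab|[x y] [n _ []//]].
  exists (Num.trunc `|x|).+1 => //; split => //=.
  by rewrite in_itv/= -ltr_norml truncnS_gt.
apply: smallest_sub; first exact: smallest_sigma_algebra.
by move=> _ [[A mA <-]|[A mA <-]]; [exact: m1|exact: m2].
Qed.

Lemma setI_closed_orects : setI_closed orects.
Proof.
have GI (A B : set R) : RGenOpens.G A -> RGenOpens.G B -> RGenOpens.G (A `&` B).
  move=> [a [b ->]] [c [d ->]]; exists (Num.max a c), (Num.min b d).
  apply/seteqP; split => x /=; rewrite !in_itv/= gt_max lt_min.
    by move=> [/andP[-> ->] /andP[-> ->]].
  by move=> /andP[/andP[-> ->] /andP[-> ->]].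
move=> _ _ [A GA [B GB <-]] [A' GA' [B' GB' <-]].
by exists (A `&` A'); [exact: GI|exists (B `&` B'); [exact: GI|exact: setXI]].
Qed.

(** Rational rectangles are countably many. Keeping the closed ones inside E leaves room for
    compactly supported bumps, while the open ones still cover E. *)
Lemma open_rect_cover (E : set R2) : open E ->
  exists a b c d : nat -> R,
    (forall n, crect (a n) (b n) (c n) (d n) `<=` E) /\
    E `<=` \bigcup_n orect (a n) (b n) (c n) (d n).
Proof.
move=> oE.
pose Q : countType := (rat * rat * (rat * rat))%type.
pose good (q : Q) :=
  crect (ratr q.1.1) (ratr q.1.2) (ratr q.2.1) (ratr q.2.2) `<=` E.
pose dec n : Q :=
  if unpickle n is Some q then if `[< good q >] then q else ((1, 0), (1, 0))
  else ((1, 0), (1, 0)).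
(* Codes that give no good rectangle are sent to one with lower end 1 and upper end 0; it is empty,
   hence inside any E. *)
have junk : good ((1, 0), (1, 0)).
  move=> x [/= + _]; rewrite in_itv/= rmorph1 rmorph0 => /andP[h1 h2].
  by have := le_trans h1 h2; rewrite ler10.
have gdec n : good (dec n).
  by rewrite /dec; case: unpickle => [q|//]; case: asboolP.
exists (fun n => ratr (dec n).1.1), (fun n => ratr (dec n).1.2),
  (fun n => ratr (dec n).2.1), (fun n => ratr (dec n).2.2); split=> // x Ex.
have [e /= e0 xeE] : exists2 e : R, 0 < e & ball x e `<=` E.
  by have /nbhs_ballP[e] := open_nbhs_nbhs (conj oE Ex); exists e.
have [a1 a2] : (x.1 - e < x.1) /\ (x.1 < x.1 + e) by split; lra.
have [b1 b2] : (x.2 - e < x.2) /\ (x.2 < x.2 + e) by split; lra.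
have [a ha] := rat_in_itvoo a1; have [b hb] := rat_in_itvoo a2.
have [c hc] := rat_in_itvoo b1; have [d hd] := rat_in_itvoo b2.
move: ha hb hc hd; rewrite !in_itv/=.
move=> /andP[ha1 ha2] /andP[hb1 hb2] /andP[hc1 hc2] /andP[hd1 hd2].
have gq : good ((a, b), (c, d)).
  move=> y [/=]; rewrite !in_itv/= => /andP[ya yb] /andP[yc yd].
  apply: xeE; split; rewrite /ball/= ltr_distlC; lra.
exists (pickle ((a, b), (c, d))) => //.
rewrite /dec pickleK; case: asboolP => // _.
by split; rewrite /= in_itv/= ?ha2 ?hb1 ?hc2 ?hd1.
Qed.

Lemma open_measurable2 (E : set R2) : open E -> measurable E.
Proof.
move=> /open_rect_cover[a [b [c [d [sub cov]]]]].
rewrite [E](_ : _ = \bigcup_n orect (a n) (b n) (c n) (d n)).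
  by apply: bigcup_measurable => n _; apply: measurableX; exact: measurable_itv.
apply/seteqP; split => // x [n _ [/= h1 h2]]; apply: (sub n).
by split => /=; apply: subset_itv_oo_cc.
Qed.

Lemma continuous_measurable_fun2 (f : R2 -> R) :
  continuous f -> measurable_fun setT f.
Proof.
move=> /continuousP cf; apply: (measurability _ (RGenOpens.measurableE R)).
move=> _ [_ [a [b ->]] <-]; rewrite setTI.
by apply: open_measurable2; exact/cf/interval_open.
Qed.

End Rectangles.

(** * Test functions *)

Section Bumps.
Variable R : realType.
Local Notation R2 := (R * R)%type.

Definition C1fun (f : R2 -> R) : Prop :=
  (forall x, differentiable f x) /\
  (forall v : R2, continuous (fun x => 'D_v f x)).

Lemma C1fun_cts f : C1fun f -> continuous f.
Proof. by move=> [df _] x; exact: differentiable_continuous. Qed.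

Lemma C1fun_cst (r : R) : C1fun (cst r).
Proof.
split=> [x|v]; first exact: differentiable_cst.
rewrite (_ : (fun x => _) = cst 0); first exact: cst_continuous.
by apply/funext => x; rewrite derive_cst.
Qed.

Lemma C1fun_fst : C1fun (fst : R2 -> R).
Proof.
have dfst (x : R2) : differentiable (fst : R2 -> R) x.
  by apply: (linear_differentiable (f := fst : R2 -> R)) => y; exact: cvg_fst.
split=> // v.
rewrite (_ : (fun x => _) = cst v.1); first exact: cst_continuous.
apply/funext => x; rewrite deriveE// (diff_lin (f := fst : R2 -> R))//.
by move=> y; exact: cvg_fst.
Qed.

Lemma C1fun_snd : C1fun (snd : R2 -> R).
Proof.
have dsnd (x : R2) : differentiable (snd : R2 -> R) x.
  by apply: (linear_differentiable (f := snd : R2 -> R)) => y; exact: cvg_snd.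
split=> // v.
rewrite (_ : (fun x => _) = cst v.2); first exact: cst_continuous.
apply/funext => x; rewrite deriveE// (diff_lin (f := snd : R2 -> R))//.
by move=> y; exact: cvg_snd.
Qed.

Lemma C1funD f g : C1fun f -> C1fun g -> C1fun (f \+ g).
Proof.
move=> [df cf] [dg cg]; split=> [x|v]; first exact: differentiableD.
rewrite (_ : (fun x => _) = (fun x => 'D_v f x + 'D_v g x)).
  by move=> x; apply: cvgD; [exact: cf|exact: cg].
by apply/funext => x; rewrite deriveD//; exact: diff_derivable.
Qed.

Lemma C1funM f g : C1fun f -> C1fun g -> C1fun (f \* g).
Proof.
move=> Cf Cg; have := C1fun_cts Cg; have := C1fun_cts Cf.
move: Cf Cg => [df cf] [dg cg] f0 g0; split=> [x|v]; first exact: differentiableM.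
rewrite (_ : (fun x => _) = (fun x => f x * 'D_v g x + g x * 'D_v f x)).
  by move=> x; apply: cvgD; apply: cvgM; [exact: f0|exact: cg|exact: g0|exact: cf].
by apply/funext => x; rewrite deriveM//; exact: diff_derivable.
Qed.

Lemma C1fun_comp (h dh : R -> R) (f : R2 -> R) :
  (forall t : R, is_derive t (1 : R) h (dh t)) ->
  continuous dh -> C1fun f -> C1fun (h \o f).
Proof.
move=> hd cdh Cf; have := C1fun_cts Cf; move: Cf => [df cf] f0.
have dh' t : differentiable h t by apply/derivable1_diffP; case: (hd t).
split=> [x|v]; first exact: differentiable_comp.
rewrite (_ : (fun x => _) = (fun x => 'D_v f x * dh (f x))).
  move=> x; apply: cvgM; first exact: cf.
  by apply: continuous_comp; [exact: f0|exact: cdh].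
apply/funext => x; rewrite deriveE; last exact: differentiable_comp.
by rewrite diff_comp//= diff1E// deriveE//= derive1E derive_val.
Qed.

(** Squaring makes the positive part C^1, which is exactly the regularity that [test_fun] asks
    for. *)
Definition posq (t : R) : R := Num.max t 0 ^+ 2.

Lemma is_derive_posq (t : R) : is_derive t (1 : R) posq (2 * Num.max t 0).
Proof.
suff h : (fun s => s^-1 *: ((posq \o shift t) (s *: 1) - posq t)) s @[s --> 0^'] --> 2 * Num.max t 0.
  by apply: DeriveDef; [apply/cvg_ex; eexists; exact: h|exact: cvg_lim].
apply/cvgrPdist_le => e e0; near=> s.
have s0 : s != 0 by near: s; exact: nbhs_dnbhs_neq.
have se : `|s| <= e.
  near: s; apply: nbhs_dnbhs; apply/nbhs_ballP; exists e => //= y.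
  by rewrite /ball/= sub0r normrN => /ltW.
apply: le_trans se; rewrite /= /posq.
(* Multiplied by |s|, the claim becomes a quadratic remainder bound, |posq (s + t) - posq t - 2 s
   max(t, 0)| <= s^2, checked on the signs of t and s + t. *)
rewrite -(ler_pM2r (_ : 0 < `|s|)) ?normr_gt0// -normrM mulrBl.
have -> : s^-1 *: (Num.max (s%:A + t) 0 ^+ 2 - Num.max t 0 ^+ 2) * s =
    Num.max (s + t) 0 ^+ 2 - Num.max t 0 ^+ 2 :> R.
  by rewrite -[s%:A]/(s * 1) -[_ *: _]/(_ * _) mulr1 mulrAC mulVf ?mul1r.
rewrite -expr2 real_normK ?num_real// ler_norml.
case: (leP (s + t) 0) => h1; case: (leP t 0) => h2; nra.
Unshelve. all: by end_near.
Qed.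

Lemma posq_C1fun f : C1fun f -> C1fun (posq \o f).
Proof.
apply: (C1fun_comp is_derive_posq) => t.
apply: cvgM; first exact: cvg_cst.
by apply: continuous_max; [exact: cvg_id|exact: cvg_cst].
Qed.

(** A C^1 step that rises from 0 at 0 to 1 at 1 and stays there. It is negative below 0, but is only
    applied to nonnegative arguments. *)
Definition ramp (t : R) : R := 1 - posq (1 - t).

Lemma ramp_itv t : 0 <= t -> 0 <= ramp t <= 1.
Proof.
by move=> t0; rewrite /ramp /posq; case: (leP (1 - t) 0) => h; apply/andP; split; nra.
Qed.

Lemma ramp0 : ramp 0 = 0.
Proof. by rewrite /ramp /posq subr0 max_l// expr1n subrr. Qed.

Lemma ramp_ge1 t : 1 <= t -> ramp t = 1.
Proof. by move=> t1; rewrite /ramp /posq max_r ?subr_le0// expr0n subr0. Qed.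

Definition rect_bump (a b c d : R) (x : R2) : R :=
  posq (x.1 - a) * posq (b - x.1) * (posq (x.2 - c) * posq (d - x.2)).

Definition bump (a b c d : R) (n : nat) (x : R2) : R :=
  ramp (n%:R * rect_bump a b c d x).

Lemma posq_ge0 t : 0 <= posq t. Proof. exact: sqr_ge0. Qed.

Lemma posq_le0 t : t <= 0 -> posq t = 0.
Proof. by move=> t0; rewrite /posq max_r// expr0n. Qed.

Lemma posq_gt0 t : 0 < t -> 0 < posq t.
Proof. by move=> t0; rewrite /posq max_l ?exprn_gt0// ltW. Qed.

Lemma rect_bump_ge0 a b c d x : 0 <= rect_bump a b c d x.
Proof. by rewrite /rect_bump; apply: mulr_ge0; apply: mulr_ge0; exact: posq_ge0. Qed.

Lemma rect_bump_out a b c d x : ~ orect a b c d x -> rect_bump a b c d x = 0.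
Proof.
move=> h; rewrite /rect_bump.
have [xa|ax] := leP x.1 a; first by rewrite (@posq_le0 (x.1 - a)) ?subr_le0// !mul0r.
have [bx|xb] := leP b x.1; first by rewrite (@posq_le0 (b - x.1)) ?subr_le0// mulr0 mul0r.
have [xc|cx] := leP x.2 c; first by rewrite (@posq_le0 (x.2 - c)) ?subr_le0// !mul0r mulr0.
have [dx|xd] := leP d x.2; first by rewrite (@posq_le0 (d - x.2)) ?subr_le0// !mulr0.
by exfalso; apply: h; split; rewrite /= in_itv/= ?ax ?cx.
Qed.

Lemma rect_bump_in a b c d x : orect a b c d x -> 0 < rect_bump a b c d x.
Proof.
move=> [/=]; rewrite !in_itv/= => /andP[? ?] /andP[? ?].
by rewrite /rect_bump; apply: mulr_gt0; apply: mulr_gt0; rewrite posq_gt0 ?subr_gt0.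
Qed.

Lemma bump_itv a b c d n x : 0 <= bump a b c d n x <= 1.
Proof. by apply: ramp_itv; rewrite mulr_ge0 ?rect_bump_ge0. Qed.

Lemma bump_out a b c d n x : ~ orect a b c d x -> bump a b c d n x = 0.
Proof. by move=> /rect_bump_out h; rewrite /bump h mulr0 ramp0. Qed.

(** [rect_bump] is positive exactly on the open rectangle: there n times its value eventually
    exceeds 1 and the sequence becomes constant, and elsewhere every term is 0. *)
Lemma bump_cvg a b c d x :
  bump a b c d n x @[n --> \oo] --> (\1_(orect a b c d) x : R).
Proof.
rewrite indicE; case: (boolP (x \in _)); rewrite ?(inE, notin_setE) => h.
  apply: cvg_near_cst; near=> n; apply: ramp_ge1.
  rewrite -ler_pdivrMr ?rect_bump_in// mul1r.
  by near: n; exact: nbhs_infty_ger.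
by under eq_fun do rewrite bump_out//; exact: cvg_cst.
Unshelve. all: by end_near.
Qed.

Lemma bump_C1fun a b c d n : C1fun (bump a b c d n).
Proof.
have lin p (r : R) : C1fun p -> C1fun (fun x => p x - r).
  by move=> Cp; apply: C1funD Cp (C1fun_cst _).
have rsub p (r : R) : C1fun p -> C1fun (fun x => r - p x).
  move=> Cp; rewrite (_ : (fun _ => _) = (cst r \+ (cst (-1) \* p))).
    by apply: C1funD (C1fun_cst _) _; apply: C1funM (C1fun_cst _) _.
  by apply/funext => x /=; rewrite mulN1r.
apply: (rsub (posq \o (fun x => 1 - n%:R * rect_bump a b c d x))).
apply: posq_C1fun; apply: (rsub); apply: C1funM (C1fun_cst _) _.
have C1 := C1fun_fst; have C2 := C1fun_snd.
apply: C1funM; apply: C1funM.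
- exact: (posq_C1fun (lin fst a C1)).
- exact: (posq_C1fun (rsub fst b C1)).
- exact: (posq_C1fun (lin snd c C2)).
- exact: (posq_C1fun (rsub snd d C2)).
Qed.

Lemma bump_test_fun a b c d n (E : set R2) :
  crect a b c d `<=` E -> test_fun E (bump a b c d n).
Proof.
move=> sE; have [d1 d2] := bump_C1fun a b c d n; split=> //.
exists (crect a b c d); split=> //.
  by apply: compact_setX; exact: segment_compact.
move=> x h; apply: bump_out; apply: contra_not h => -[/= h1 h2].
by split; exact: subset_itv_oo_cc.
Qed.

End Bumps.

(** * The fundamental lemma *)

Section Dynkin.
Context d (T : measurableType d) (R : realType) (mu : {measure set T -> \bar R}).

(** The sets over which f integrates to 0 form a Dynkin class; the zero total integral is what gives
    stability under complement. *)
Lemma integral_pi_eq0 (G : set (set T)) (f : T -> \bar R) :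
  @measurable _ T = <<s G >> -> setI_closed G -> mu.-integrable setT f ->
  (\int[mu]_x f x = 0)%E -> (forall A, G A -> (\int[mu]_(x in A) f x = 0)%E) ->
  {ae mu, forall x, f x = 0%E}.
Proof.
move=> mG GI fi f0 Gf.
have h A : measurable A -> (\int[mu]_(x in A) f x = 0)%E.
  move=> mA; have := mA; rewrite [X in X A -> _]mG.
  apply: (dynkin_induction (P := fun A => (\int[mu]_(x in A) f x = 0)%E) mG GI) => //.
  - move=> S mS S0; have := f0; rewrite -(setUv S) integral_setU//.
    + by rewrite S0 add0e.
    + exact: measurableC.
    + by rewrite setUv; exact: measurable_int fi.
    + by rewrite disj_set2E setICr.
  - move=> F mF tF F0; rewrite integral_bigcup//.
      by rewrite eseries0// => i _ _; exact: F0.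
    by apply: integrableS fi => //; exact: bigcup_measurable.
have : ae_eq mu setT f (cst 0%E).
  apply: integral_ae_eq => // A _ mA.
  by rewrite h// integral0.
by apply: filterS => x /=; apply.
Qed.
(** Extending g by zero outside Q turns integrals over A into integrals over the trace of A on Q, so
    a problem localized to Q reduces to the whole space. *)
Lemma integral_pi_trace_eq0 (G : set (set T)) (E Q : set T) (g : T -> R) :
  @measurable _ T = <<s G >> -> setI_closed G ->
  measurable E -> measurable Q -> Q `<=` E -> mu.-integrable E (EFin \o g) ->
  (\int[mu]_(x in Q) (g x)%:E = 0)%E ->
  (forall A, G A -> (\int[mu]_(x in A `&` Q) (g x)%:E = 0)%E) ->
  mu.-negligible [set x | Q x /\ g x != 0].
Proof.
move=> mG GI mE mQ QE gi g0 Gg.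
suff : {ae mu, forall x, ((EFin \o g) \_ Q) x = 0%E}.
  apply: negligibleS => x /= [Qx gx].
  by rewrite patchE mem_set// => -[] /eqP; exact/negP.
apply: (integral_pi_eq0 mG GI).
- by have /integrable_mkcond := integrableS mE mQ QE gi; apply.
- by rewrite -integral_mkcond.
- by move=> A GA; rewrite -integral_mkcondr; exact: Gg.
Qed.

End Dynkin.

Section Fundamental.
Variable R : realType.
Local Notation R2 := (R * R)%type.
Local Notation mu2 := (leb2 R).

(** The bumps are test functions with values in [0, 1] converging to the indicator of the rectangle,
    so dominated convergence with bound |g| passes to the limit. *)
Lemma integral_orect_eq0 (E : set R2) (g : R2 -> R) (a b c d : R) :
  open E -> mu2.-integrable E (EFin \o g) ->
  (forall phi, test_fun E phi -> \int[mu2]_(x in E) (g x * phi x) = 0) ->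
  crect a b c d `<=` E -> (\int[mu2]_(x in orect a b c d) (g x)%:E = 0)%E.
Proof.
move=> oE gi g0 sE; have mE := open_measurable2 oE.
have mQ : measurable (orect a b c d) by apply: measurableX; exact: measurable_itv.
have mg := measurable_int _ gi.
have mb n : measurable_fun E (bump a b c d n).
  apply: measurable_funTS; apply: continuous_measurable_fun2.
  exact: C1fun_cts (bump_C1fun _ _ _ _ _).
have mbg n : measurable_fun E (fun x => g x * bump a b c d n x).
  by apply: measurable_funM => //; exact/measurable_EFinP.
have bgi n : mu2.-integrable E (EFin \o (fun x => g x * bump a b c d n x)).
  apply: (le_integrable _ _ _ gi) => //; first by apply/measurable_EFinP; exact: mbg.
  move=> x _ /=; rewrite lee_fin normrM ler_piMr//.
  by have /andP[b0 b1] := bump_itv a b c d n x; rewrite ger0_norm.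
have fE x : ((EFin \o g) \_ (orect a b c d)) x = (g x * \1_(orect a b c d) x)%:E.
  by rewrite patchE indicE; case: ifP => _; rewrite /= ?mulr1 ?mulr0.
have QE : E `&` orect a b c d = orect a b c d.
  apply/setIidr; apply: subset_trans sE => x [/= h1 h2].
  by split; apply: subset_itv_oo_cc.
have [] := @dominated_convergence _ _ _ mu2 E mE
  (fun n x => (g x * bump a b c d n x)%:E)
  ((EFin \o g) \_ (orect a b c d)) (fun x => `|(g x)%:E|%E).
- by move=> n; apply/measurable_EFinP; exact: mbg.
- apply/measurable_restrict => //; rewrite QE.
  by apply: measurable_funS mg => //; rewrite -QE; exact: subIsetl.
- apply: aeW => x _; rewrite fE; apply: cvg_EFin; first by near=> n.
  by apply: cvgM; [exact: cvg_cst|exact: bump_cvg].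
- exact: integrable_abse.
- apply: aeW => x n _ /=; rewrite lee_fin normrM ler_piMr//.
  by have /andP[b0 b1] := bump_itv a b c d n x; rewrite (ger0_norm b0).
move=> _ _; rewrite -integral_mkcondr QE.
have z n : (\int[mu2]_(x in E) (g x * bump a b c d n x)%:E = 0)%E.
  rewrite -[LHS]fineK; last by apply: (integrable_fin_num _ (bgi n)); exact: mE.
  by congr EFin; exact: g0 _ (bump_test_fun n sE).
under eq_fun do rewrite z.
by move=> /cvg_lim <-//; rewrite lim_cst.
Unshelve. all: by end_near.
Qed.

(** Countably many rectangles with closure in E cover E, so one of them, Q, is enough. The trace on
    Q of an open rectangle is again an open rectangle with closure in E, so g has zero integral on Q
    and on the traces of a generating pi-system. *)
Lemma fundamental_lemma (E : set R2) (g : R2 -> R) :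
  open E -> mu2.-integrable E (EFin \o g) ->
  (forall phi, test_fun E phi -> \int[mu2]_(x in E) (g x * phi x) = 0) ->
  {ae mu2, forall x, E x -> g x = 0}.
Proof.
move=> oE gi g0; have mE := open_measurable2 oE.
have [a [b [c [d [sub cov]]]]] := open_rect_cover oE.
pose N n := [set x | orect (a n) (b n) (c n) (d n) x /\ g x != 0].
suff : mu2.-negligible (\bigcup_n N n).
  apply: negligibleS => x /= /not_implyP[Ex gx]; have [n _ nx] := cov x Ex.
  by exists n => //; split=> //; exact/eqP.
apply: negligible_bigcup => n; rewrite /N.
move: (a n) (b n) (c n) (d n) (sub n) => {N a b c d sub cov n} a b c d sE.
have QE : E `&` orect a b c d = orect a b c d.
  apply/setIidr; apply: subset_trans sE => x [/= h1 h2].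
  by split; apply: subset_itv_oo_cc.
have mQ : measurable (orect a b c d) by apply: measurableX; exact: measurable_itv.
apply: (@integral_pi_trace_eq0 _ _ R mu2 (@orects R) E) => //.
- exact: measurable_orects.
- exact: setI_closed_orects.
- by rewrite -QE; exact: subIsetl.
- exact: integral_orect_eq0 sE.
move=> _ [A [a1 [b1 ->]] [B [c1 [d1 ->]] <-]].
have -> : `]a1, b1[ `*` `]c1, d1[ `&` orect a b c d =
    orect (Num.max a1 a) (Num.min b1 b) (Num.max c1 c) (Num.min d1 d).
  apply/seteqP; split => -[x y]; rewrite /orect/= !in_itv/= !gt_max !lt_min.
    by move=> [[/andP[-> ->] /andP[-> ->]] [/andP[-> ->] /andP[-> ->]]].
  by move=> [/andP[/andP[-> ->] /andP[-> ->]] /andP[/andP[-> ->] /andP[-> ->]]].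
apply: (integral_orect_eq0 oE gi g0); apply: subset_trans sE => -[x y].
rewrite /crect/= !in_itv/= !ge_max !le_min.
by move=> [/andP[/andP[_ ->] /andP[_ ->]] /andP[/andP[_ ->] /andP[_ ->]]].
Qed.

End Fundamental.

(** * Square integrable functions *)

Section SquareIntegrable.
Context d (T : measurableType d) (R : realType) (mu : {measure set T -> \bar R}).
Variables (E : set T).
Hypothesis mE : measurable E.
Implicit Types f g k : T -> R.

(** The predicate [L2] over an arbitrary measure space. *)
Definition sqint f : Prop :=
  measurable_fun E f /\ mu.-integrable E (fun x => (f x ^+ 2)%:E).

Lemma integrable_dominated_ae f g : measurable_fun E f ->
  {ae mu, forall x, E x -> `|f x| <= g x} ->
  mu.-integrable E (EFin \o g) -> mu.-integrable E (EFin \o f).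
Proof.
move=> mf fg /integrableP[mg goo].
have mf' : measurable_fun E (EFin \o f) by exact/measurable_EFinP.
apply/integrableP; split=> //; apply: le_lt_trans goo.
apply: ae_ge0_le_integral => //; try exact: measurableT_comp.
by apply: filterS fg => x fg Ex; rewrite lee_fin (le_trans (fg Ex))// ler_norm.
Qed.

Lemma integrable_dominated f g : measurable_fun E f -> (forall x, E x -> `|f x| <= g x) ->
  mu.-integrable E (EFin \o g) -> mu.-integrable E (EFin \o f).
Proof. by move=> mf fg; apply: integrable_dominated_ae => //; exact: aeW. Qed.

Lemma integrable_EFinD f g : mu.-integrable E (EFin \o f) ->
  mu.-integrable E (EFin \o g) -> mu.-integrable E (EFin \o (fun x => f x + g x)).
Proof. by move=> fi gi; apply: eq_integrable (integrableD mE fi gi). Qed.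

Lemma integrable_EFinZ (r : R) f : mu.-integrable E (EFin \o f) ->
  mu.-integrable E (EFin \o (fun x => r * f x)).
Proof. by move=> fi; apply: eq_integrable (integrableZl mE r fi). Qed.

Lemma integrable_sqintM f g : sqint f -> sqint g ->
  mu.-integrable E (EFin \o (fun x => f x * g x)).
Proof.
move=> [mf fi] [mg gi].
apply: (@integrable_dominated _ (fun x => f x ^+ 2 + g x ^+ 2)).
- exact: measurable_funM.
- by move=> x _; rewrite ler_norml; apply/andP; split; nra.
- exact: integrable_EFinD.
Qed.

Lemma sqint_lin (r : R) f g : sqint f -> sqint g -> sqint (fun x => r * f x + g x).
Proof.
move=> [mf fi] [mg gi].
have m : measurable_fun E (fun x => r * f x + g x).
  by apply: measurable_funD => //; apply: measurable_funM.
split=> //; apply: (@integrable_dominated (fun x => (r * f x + g x) ^+ 2)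
  (fun x => (2 * r ^+ 2) * f x ^+ 2 + 2 * g x ^+ 2)).
- exact: measurable_funX.
- move=> x _; rewrite ger0_norm ?sqr_ge0//.
  by have := sqr_ge0 (r * f x - g x); nra.
- by apply: integrable_EFinD; exact: integrable_EFinZ.
Qed.

Lemma sqint_bounded f (M : R) : (mu E < +oo)%E -> measurable_fun E f ->
  (forall x, E x -> `|f x| <= M) -> sqint f.
Proof.
move=> fE mf fM; split=> //.
apply: (@integrable_dominated _ (cst (M ^+ 2))); first exact: measurable_funX.
  by move=> x Ex; rewrite normrX lerXn2r ?nnegrE ?fM// (le_trans _ (fM x Ex)).
apply: measurable_bounded_integrable => //; exists `|M ^+ 2|; split; rewrite ?num_real//.
by move=> r /ltW Mr x _.
Qed.

Lemma sqint_integrable f : (mu E < +oo)%E -> sqint f -> mu.-integrable E (EFin \o f).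
Proof.
move=> fE sf; have s1 : sqint (cst 1).
  by apply: (@sqint_bounded _ 1) => // x _; rewrite normr1.
by have := integrable_sqintM sf s1; apply: eq_integrable => // x _ /=; rewrite mulr1.
Qed.

Lemma sqint_boundedM k (M : R) f : measurable_fun E k ->
  {ae mu, forall x, E x -> `|k x| <= M} -> sqint f -> sqint (fun x => k x * f x).
Proof.
move=> mk kM [mf fi]; have m : measurable_fun E (fun x => k x * f x).
  exact: measurable_funM.
split=> //; apply: (@integrable_dominated_ae (fun x => (k x * f x) ^+ 2)
  (fun x => M ^+ 2 * f x ^+ 2)); first exact: measurable_funX.
  apply: filterS kM => x kM Ex; rewrite ger0_norm ?sqr_ge0// exprMn.
  rewrite ler_wpM2r ?sqr_ge0// -real_normK ?num_real// lerXn2r ?nnegrE ?kM//.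
  exact: le_trans (kM Ex).
exact: integrable_EFinZ.
Qed.

Lemma ae_eq_Rintegral f g : measurable_fun E f -> measurable_fun E g ->
  {ae mu, forall x, E x -> f x = g x} -> \int[mu]_(x in E) f x = \int[mu]_(x in E) g x.
Proof.
move=> mf mg fg; congr fine; apply: ae_eq_integral => //; [exact/measurable_EFinP..|].
by apply: filterS fg => x fg Ex; rewrite fg.
Qed.

Lemma Rintegral_lin (r : R) f g : mu.-integrable E (EFin \o f) ->
  mu.-integrable E (EFin \o g) ->
  \int[mu]_(x in E) (r * f x + g x) =
  r * (\int[mu]_(x in E) f x) + \int[mu]_(x in E) g x.
Proof.
move=> fi gi; rewrite RintegralD//; first by rewrite RintegralZl.
exact: integrable_EFinZ.
Qed.

End SquareIntegrable.

Lemma Rintegral_support d (T : measurableType d) (R : realType)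
    (mu : {measure set T -> \bar R}) (E U : set T) (f : T -> R) :
  E `<=` U -> (forall x, ~ E x -> f x = 0) ->
  \int[mu]_(x in U) f x = \int[mu]_(x in E) f x.
Proof.
move=> EU f0; rewrite Rintegral_mkcond [RHS]Rintegral_mkcond; congr Rintegral.
apply/funext => x; rewrite !patchE.
have [/set_mem Ex|/negP nE] := boolP (x \in E); first by rewrite mem_set//; exact: EU.
by rewrite (f0 x) ?if_same// => Ex; apply: nE; exact: mem_set.
Qed.

(** * Weak gradients *)

Section WeakGradient.
Variable R : realType.
Local Notation R2 := (R * R)%type.
Local Notation mu2 := (leb2 R).
Implicit Types (E U : set R2) (u v : R2 -> R) (g h : R2 -> R2).

Lemma L2_lin E (r : R) (f f' : R2 -> R) : measurable E -> L2 E f -> L2 E f' ->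
  L2 E (fun x => r * f x + f' x).
Proof. by move=> mE; apply: (@sqint_lin _ _ R mu2 E mE). Qed.

Lemma Rintegral2_lin E (r : R) (f f' : R2 -> R) : measurable E ->
  mu2.-integrable E (EFin \o f) -> mu2.-integrable E (EFin \o f') ->
  \int[mu2]_(x in E) (r * f x + f' x) =
  r * (\int[mu2]_(x in E) f x) + \int[mu2]_(x in E) f' x.
Proof. by move=> mE; apply: (@Rintegral_lin _ _ R mu2 E mE). Qed.

Lemma integrable_L2M E (f f' : R2 -> R) : measurable E -> L2 E f -> L2 E f' ->
  mu2.-integrable E (EFin \o (fun x => f x * f' x)).
Proof. by move=> mE; apply: (@integrable_sqintM _ _ R mu2 E mE). Qed.

Lemma L2_bounded E (f : R2 -> R) (M : R) : measurable E -> (mu2 E < +oo)%E ->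
  measurable_fun E f -> (forall x, E x -> `|f x| <= M) -> L2 E f.
Proof. by move=> mE; apply: (@sqint_bounded _ _ R mu2 E mE). Qed.

Lemma L2_integrable E (f : R2 -> R) : measurable E -> (mu2 E < +oo)%E ->
  L2 E f -> mu2.-integrable E (EFin \o f).
Proof. by move=> mE; apply: (@sqint_integrable _ _ R mu2 E mE). Qed.

Lemma L2_sub E U (f : R2 -> R) : measurable E -> measurable U -> E `<=` U ->
  L2 U f -> L2 E f.
Proof.
move=> mE mU EU [mf fi]; split; first exact: measurable_funS mf.
by apply: (@integrableS _ _ R mu2 U E).
Qed.

Lemma ae2_impl (P Q : R2 -> Prop) : (forall x, P x -> Q x) ->
  {ae mu2, forall x, P x} -> {ae mu2, forall x, Q x}.
Proof. by move=> PQ; apply: negligibleS => x /=; exact/contra_not/PQ. Qed.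

Lemma ae2_and (P Q : R2 -> Prop) : {ae mu2, forall x, P x} ->
  {ae mu2, forall x, Q x} -> {ae mu2, forall x, P x /\ Q x}.
Proof.
move=> p q; apply: (negligibleS _ (negligibleU p q)) => x /= /not_andP.
by case=> ?; [left|right].
Qed.

(** Finite measure turns square integrability into integrability, as the fundamental lemma requires,
    and makes bounded functions such as test functions square integrable. *)
Definition fin_open E := open E /\ (mu2 E < +oo)%E.

Lemma fin_open_measurable E : fin_open E -> measurable E.
Proof. by move=> [oE _]; exact: open_measurable2. Qed.

Lemma compact_support_bounded (f : R2 -> R) (K : set R2) : continuous f ->
  compact K -> (forall x, ~ K x -> f x = 0) -> exists M, forall x, `|f x| <= M.
Proof.
move=> cf cK fK; have : compact (f @` K).
  by apply: continuous_compact => //; exact: continuous_subspaceT.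
move=> /compact_bounded[M [Mr MM]]; exists (`|M| + 1) => x.
have [Kx|/fK ->] := pselect (K x); last by rewrite normr0 addr_ge0.
by apply: MM; [rewrite (le_lt_trans (ler_norm M))// ltrDl|exists x].
Qed.

Lemma derive_outside (f : R2 -> R) (K : set R2) (v x : R2) : compact K ->
  (forall y, ~ K y -> f y = 0) -> ~ K x -> 'D_v f x = 0.
Proof.
move=> cK fK Kx; have oK : open (~` K).
  by apply: closed_openC; apply: compact_closed => //; exact: norm_hausdorff.
have -> : 'D_v f x = 'D_v (cst 0) x.
  apply: near_eq_derive.
  by apply: filterS (open_nbhs_nbhs (conj oK Kx)) => y /fK.
by rewrite derive_cst.
Qed.

Lemma test_funS E U phi : E `<=` U -> test_fun E phi -> test_fun U phi.
Proof.
move=> EU [d1 d2 [K [cK KE K0]]]; split=> //.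
by exists K; split=> //; exact: subset_trans EU.
Qed.

Lemma test_fun_out E phi x : test_fun E phi -> ~ E x -> phi x = 0.
Proof. by move=> [_ _ [K [_ KE K0]]] Ex; apply: K0; exact: contra_not (KE x) Ex. Qed.

Lemma test_fun_derive_out E phi (v x : R2) : test_fun E phi -> ~ E x -> 'D_v phi x = 0.
Proof.
move=> [_ _ [K [cK KE K0]]] Ex; apply: (@derive_outside phi K v x cK K0).
by move=> /KE.
Qed.

Lemma test_fun_L2 U E phi : fin_open U -> test_fun E phi -> L2 U phi.
Proof.
move=> fU [d1 _ [K [cK _ K0]]].
have cphi : continuous phi by move=> x; exact: differentiable_continuous.
have [M phiM] := compact_support_bounded cphi cK K0.
apply: (@L2_bounded _ _ M); [exact: fin_open_measurable|by case: fU| |by []].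
by apply: measurable_funTS; exact: continuous_measurable_fun2.
Qed.

Lemma test_fun_derive_L2 U E phi (v : R2) : fin_open U -> test_fun E phi ->
  L2 U ('D_v phi).
Proof.
move=> fU [d1 d2 [K [cK _ K0]]].
have [M phiM] := compact_support_bounded (d2 v) cK
  (fun x => @derive_outside phi K v x cK K0).
apply: (@L2_bounded _ _ M); [exact: fin_open_measurable|by case: fU| |by []].
by apply: measurable_funTS; apply: continuous_measurable_fun2; exact: d2.
Qed.

Lemma weak_gradient_lin E (r : R) u v g h : fin_open E -> L2 E u -> L2 E v ->
  weak_gradient E u g -> weak_gradient E v h ->
  weak_gradient E (fun x => r * u x + v x)
    (fun x => (r * (g x).1 + (h x).1, r * (g x).2 + (h x).2)).
Proof.
move=> fE Lu Lv [g1 g2 Hg] [h1 h2 Hh]; have mE := fin_open_measurable fE.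
split; [exact: L2_lin|exact: L2_lin|move=> phi tphi].
have sp := test_fun_L2 fE tphi.
have sd w := test_fun_derive_L2 w fE tphi.
have lin (a b c : R2 -> R) : L2 E a -> L2 E b -> L2 E c ->
    \int[mu2]_(x in E) ((r * a x + b x) * c x) =
    r * (\int[mu2]_(x in E) (a x * c x)) + \int[mu2]_(x in E) (b x * c x).
  move=> sa sb sc; rewrite -Rintegral2_lin//; try exact: integrable_L2M.
  by apply: eq_Rintegral => x _; rewrite mulrDl mulrA.
have [Hg1 Hg2] := Hg _ tphi; have [Hh1 Hh2] := Hh _ tphi.
have comb (I J I' J' K K' : R) : K = r * I + J -> I = - I' -> J = - J' ->
    K' = r * I' + J' -> K = - K' by move=> -> -> -> ->; rewrite mulrN opprD.
split; first exact: comb (lin u v _ Lu Lv (sd e1)) Hg1 Hh1 (lin _ _ _ g1 h1 sp).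
exact: comb (lin u v _ Lu Lv (sd e2)) Hg2 Hh2 (lin _ _ _ g2 h2 sp).
Qed.

(** A test function on E is one on U, and it vanishes off E together with its derivatives, so
    integrating over E or over U is the same. *)
Lemma weak_gradient_sub E U u g : open E -> open U -> E `<=` U ->
  weak_gradient U u g -> weak_gradient E u g.
Proof.
move=> oE oU EU; have [mE mU] := (open_measurable2 oE, open_measurable2 oU).
have L2S (f : R2 -> R) : L2 U f -> L2 E f by exact: L2_sub.
move=> [g1 g2 Hg]; split; [exact: L2S|exact: L2S|move=> phi tphi].
have [Hg1 Hg2] := Hg _ (test_funS EU tphi).
have sup (f c : R2 -> R) : (forall x, ~ E x -> c x = 0) ->
    \int[mu2]_(x in E) (f x * c x) = \int[mu2]_(x in U) (f x * c x).
  by move=> c0; symmetry; apply: Rintegral_support => // x /c0 ->; rewrite mulr0.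
have p0 x : ~ E x -> phi x = 0 by exact: test_fun_out tphi.
have d0 (w x : R2) : ~ E x -> 'D_w phi x = 0 by exact: test_fun_derive_out tphi.
split; first exact: etrans (sup u _ (d0 e1)) (etrans Hg1 (congr1 _ (esym (sup _ _ p0)))).
exact: etrans (sup u _ (d0 e2)) (etrans Hg2 (congr1 _ (esym (sup _ _ p0)))).
Qed.

(** Componentwise, the difference of two weak gradients integrates to 0 against every test function,
    so the fundamental lemma applies. *)
Lemma weak_gradient_unique E u g h : fin_open E ->
  weak_gradient E u g -> weak_gradient E u h ->
  {ae mu2, forall x, E x -> g x = h x}.
Proof.
move=> fE [g1 g2 Hg] [h1 h2 Hh]; have mE := fin_open_measurable fE.
have [oE fin] := fE.
have key (a b : R2 -> R) : L2 E a -> L2 E b ->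
    (forall phi, test_fun E phi ->
      \int[mu2]_(x in E) (a x * phi x) = \int[mu2]_(x in E) (b x * phi x)) ->
    {ae mu2, forall x, E x -> a x = b x}.
  move=> sa sb ab.
  have sba : L2 E (fun x => -1 * b x + a x) by exact: L2_lin.
  have : {ae mu2, forall x, E x -> -1 * b x + a x = 0}.
    apply: fundamental_lemma => //; first exact: L2_integrable.
    move=> phi tphi; have sp := test_fun_L2 fE tphi.
    transitivity (\int[mu2]_(x in E) (-1 * (b x * phi x) + a x * phi x)).
      by apply: eq_Rintegral => x _; rewrite mulrDl mulrA.
    rewrite Rintegral2_lin//; try exact: integrable_L2M.
    by rewrite ab// mulN1r addNr.
  by apply: ae2_impl => x h0 Ex; move: (h0 Ex) => /eqP; rewrite mulN1r addrC subr_eq0 => /eqP.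
have e1 : {ae mu2, forall x, E x -> (g x).1 = (h x).1}.
  apply: key => // phi tphi; have [Hg1 _] := Hg _ tphi; have [Hh1 _] := Hh _ tphi.
  by apply: oppr_inj; rewrite -Hg1 -Hh1.
have e2 : {ae mu2, forall x, E x -> (g x).2 = (h x).2}.
  apply: key => // phi tphi; have [_ Hg1] := Hg _ tphi; have [_ Hh1] := Hh _ tphi.
  by apply: oppr_inj; rewrite -Hg1 -Hh1.
apply: ae2_impl (ae2_and e1 e2) => x [h1' h2'] Ex.
by rewrite (surjective_pairing (g x)) (surjective_pairing (h x)) h1'// h2'.
Qed.

Lemma grad_weak E u : H1 E u -> weak_gradient E u (grad E u).
Proof. by move=> [_ /(xgetPex (fun=> (0, 0)))]. Qed.

Lemma H1_lin E (r : R) u v : fin_open E -> H1 E u -> H1 E v ->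
  H1 E (fun x => r * u x + v x).
Proof.
move=> fE [Lu [g Hg]] [Lv [h Hh]]; split.
  by apply: L2_lin => //; exact: fin_open_measurable.
by eexists; exact: weak_gradient_lin Hg Hh.
Qed.

Lemma H1_0 E : fin_open E -> H1 E (fun=> 0).
Proof.
move=> fE; have mE := fin_open_measurable fE.
have s0 : L2 E (fun=> 0).
  apply: (@L2_bounded _ _ 0) => //; first by case: fE.
  by move=> x _; rewrite normr0.
split=> //; exists (fun=> (0, 0)); split=> // phi _ /=.
have z (f : R2 -> R) : \int[mu2]_(x in E) (0 * f x) = 0.
  under eq_Rintegral do rewrite mul0r.
  by rewrite Rintegral_cst// mul0r.
by split; rewrite [LHS]z [in RHS]z oppr0.
Qed.

Lemma H1_sub E U u : open E -> open U -> E `<=` U -> H1 U u -> H1 E u.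
Proof.
move=> oE oU EU [Lu [g Hg]]; split; last by exists g; exact: weak_gradient_sub Hg.
exact: (L2_sub (open_measurable2 oE) (open_measurable2 oU) EU).
Qed.

(** The chosen gradient of a combination need not be the combination of the chosen gradients;
    uniqueness identifies them up to a null set. *)
Lemma grad_lin E (r : R) u v : fin_open E -> H1 E u -> H1 E v ->
  {ae mu2, forall x, E x -> grad E (fun x => r * u x + v x) x =
    (r * (grad E u x).1 + (grad E v x).1, r * (grad E u x).2 + (grad E v x).2)}.
Proof.
move=> fE Hu Hv; apply: (weak_gradient_unique fE (grad_weak (H1_lin r fE Hu Hv))).
by apply: weak_gradient_lin; [|case: Hu|case: Hv|exact: grad_weak|exact: grad_weak].
Qed.

Lemma grad_sub E U u : fin_open E -> open U -> E `<=` U -> H1 U u ->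
  {ae mu2, forall x, E x -> grad E u x = grad U u x}.
Proof.
move=> fE oU EU Hu; have [oE _] := fE; apply: (weak_gradient_unique fE).
  by apply: grad_weak; exact: H1_sub Hu.
by apply: weak_gradient_sub (grad_weak Hu).
Qed.

Lemma grad_eq0 E u : fin_open E -> H1 E u -> (forall x, E x -> u x = 0) ->
  {ae mu2, forall x, E x -> grad E u x = (0, 0)}.
Proof.
move=> fE Hu u0; have mE := fin_open_measurable fE.
apply: (weak_gradient_unique fE (grad_weak Hu)).
have [s0 _] := H1_0 fE; split=> // phi _ /=.
have z (f g : R2 -> R) : (forall x, E x -> g x = 0) -> \int[mu2]_(x in E) (g x * f x) = 0.
  move=> g0; transitivity (\int[mu2]_(x in E) (0 : R)).
    by apply: eq_Rintegral => x /set_mem Ex; rewrite g0// mul0r.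
  by rewrite Rintegral_cst// mul0r.
by split; rewrite [LHS]z// [in RHS]z// oppr0.
Qed.

End WeakGradient.

(** * Bilinear forms *)

Section Forms.
Variable R : realType.
Local Notation R2 := (R * R)%type.
Local Notation mu2 := (leb2 R).
Implicit Types (E U : set R2) (u v w : R2 -> R) (g h : R2 -> R2) (k : R2 -> 'M[R]_2).

Lemma Rintegral2_ae_eq E (f f' : R2 -> R) : measurable E ->
  measurable_fun E f -> measurable_fun E f' ->
  {ae mu2, forall x, E x -> f x = f' x} ->
  \int[mu2]_(x in E) f x = \int[mu2]_(x in E) f' x.
Proof. by move=> mE; apply: (@ae_eq_Rintegral _ _ R mu2 E mE). Qed.

Lemma L2D E (f f' : R2 -> R) : measurable E -> L2 E f -> L2 E f' ->
  L2 E (fun x => f x + f' x).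
Proof.
move=> mE Lf Lf'; have := L2_lin 1 mE Lf Lf'.
by under eq_fun do rewrite mul1r.
Qed.

Definition bounded_field E k : Prop :=
  (forall i j, measurable_fun E (fun x => k x i j)) /\
  exists M, forall i j, {ae mu2, forall x, E x -> `|k x i j| <= M}.

Lemma bounded_field_cst E (A : 'M[R]_2) : bounded_field E (fun=> A).
Proof.
split=> [i j|]; first exact: measurable_cst.
exists (\sum_i \sum_j `|A i j|) => i j; apply: aeW => x _.
rewrite (bigD1 i)//= (bigD1 j)//= -addrA lerDl addr_ge0// sumr_ge0// => ? _.
by rewrite sumr_ge0.
Qed.

Lemma bounded_field_sub E U k : E `<=` U -> measurable U -> bounded_field U k ->
  bounded_field E k.
Proof.
move=> EU mU [mk [M kM]]; split=> [i j|]; first exact: measurable_funS (mk i j).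
by exists M => i j; apply: ae2_impl (kM i j) => x kx /EU.
Qed.

Lemma L2_field E (k : R2 -> R) (M : R) (f : R2 -> R) : measurable E ->
  measurable_fun E k -> {ae mu2, forall x, E x -> `|k x| <= M} -> L2 E f ->
  L2 E (fun x => k x * f x).
Proof. by move=> mE; apply: (@sqint_boundedM _ _ R mu2 E mE k M). Qed.

Definition L2v E g : Prop := L2 E (fun x => (g x).1) /\ L2 E (fun x => (g x).2).

Lemma L2v_mxact E k g : measurable E -> bounded_field E k -> L2v E g ->
  L2v E (fun x => mxact (k x) (g x)).
Proof.
move=> mE [mk [M kM]] [g1 g2].
by split; apply: L2D => //; apply: (@L2_field _ _ M).
Qed.

Lemma integrable_dot E g h : measurable E -> L2v E g -> L2v E h ->
  mu2.-integrable E (EFin \o (fun x => dot (g x) (h x))).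
Proof.
move=> mE [g1 g2] [h1 h2]; apply: (@integrable_EFinD _ _ R mu2 E mE);
  exact: integrable_L2M.
Qed.

Lemma integrable_measurable E (f : R2 -> R) : mu2.-integrable E (EFin \o f) ->
  measurable_fun E f.
Proof. by move=> /measurable_int/measurable_EFinP. Qed.

Lemma L2v_grad E u : H1 E u -> L2v E (grad E u).
Proof. by move=> /grad_weak[]. Qed.

Lemma integrable_stiffness E k u v : fin_open E -> bounded_field E k ->
  H1 E u -> H1 E v ->
  mu2.-integrable E (EFin \o (fun x => dot (mxact (k x) (grad E u x)) (grad E v x))).
Proof.
move=> fE bk Hu Hv; have mE := fin_open_measurable fE.
by apply: integrable_dot => //; [apply: L2v_mxact => //|]; exact: L2v_grad.
Qed.

Lemma measurable_stiffness E k u v : fin_open E -> bounded_field E k ->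
  H1 E u -> H1 E v ->
  measurable_fun E (fun x => dot (mxact (k x) (grad E u x)) (grad E v x)).
Proof.
by move=> fE bk Hu Hv; apply: integrable_measurable (integrable_stiffness fE bk Hu Hv).
Qed.

Lemma stiffness_linl E k (r : R) u v w : fin_open E -> bounded_field E k ->
  H1 E u -> H1 E v -> H1 E w ->
  stiffness k E (fun x => r * u x + v x) w = r * stiffness k E u w + stiffness k E v w.
Proof.
move=> fE bk Hu Hv Hw; have mE := fin_open_measurable fE.
rewrite /stiffness -Rintegral2_lin//; try exact: integrable_stiffness.
apply: Rintegral2_ae_eq => //.
- by apply: measurable_stiffness => //; exact: H1_lin.
- apply: integrable_measurable; apply: (@integrable_EFinD _ _ R mu2 E mE).
    by apply: (@integrable_EFinZ _ _ R mu2 E mE); exact: integrable_stiffness.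
  exact: integrable_stiffness.
apply: ae2_impl (grad_lin r fE Hu Hv) => x /[apply] ->.
move: (k x) (grad E u x) (grad E v x) (grad E w x) => A a b c.
by rewrite /dot /mxact/=; ring.
Qed.

Lemma stiffness_sym E k u v : fin_open E -> bounded_field E k ->
  {ae mu2, forall x, E x -> symmetric_mx (k x)} -> H1 E u -> H1 E v ->
  stiffness k E u v = stiffness k E v u.
Proof.
move=> fE bk ks Hu Hv; have mE := fin_open_measurable fE.
apply: Rintegral2_ae_eq => //; try exact: measurable_stiffness.
apply: ae2_impl ks => x /[apply] /matrixP/(_ 0 1).
move: (k x) (grad E u x) (grad E v x) => A a b.
by rewrite mxE /dot /mxact/= => ->; ring.
Qed.

Lemma stiffness_eq0 E k u w : fin_open E -> bounded_field E k -> H1 E u -> H1 E w ->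
  (forall x, E x -> u x = 0) -> stiffness k E u w = 0.
Proof.
move=> fE bk Hu Hw u0; have mE := fin_open_measurable fE.
transitivity (\int[mu2]_(x in E) (0 : R)); last by rewrite Rintegral_cst// mul0r.
apply: Rintegral2_ae_eq => //; first exact: measurable_stiffness.
apply: ae2_impl (grad_eq0 fE Hu u0) => x /[apply] ->.
by rewrite /dot /mxact/= !mulr0 !addr0 !mul0r addr0.
Qed.

Lemma Rintegral2_ae_ge0 E (f : R2 -> R) : measurable E -> measurable_fun E f ->
  {ae mu2, forall x, E x -> 0 <= f x} -> 0 <= \int[mu2]_(x in E) f x.
Proof.
move=> mE mf f0.
rewrite (@Rintegral2_ae_eq E f (fun x => Num.max (f x) 0))//.
- by apply: Rintegral_ge0 => x _; rewrite le_max lexx orbT.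
- by apply: measurable_maxr => //.
- by apply: ae2_impl f0 => x /[apply] f0; rewrite max_l.
Qed.

Lemma Rintegral2_ae_le E (f f' : R2 -> R) : measurable E ->
  mu2.-integrable E (EFin \o f) -> mu2.-integrable E (EFin \o f') ->
  {ae mu2, forall x, E x -> f x <= f' x} ->
  \int[mu2]_(x in E) f x <= \int[mu2]_(x in E) f' x.
Proof.
move=> mE fi fi' ff'; rewrite -subr_ge0 -[X in 0 <= _ - X]mul1r -mulNr addrC.
rewrite -Rintegral2_lin//; apply: Rintegral2_ae_ge0 => //.
  apply: integrable_measurable; apply: (@integrable_EFinD _ _ R mu2 E mE) => //.
  exact: (@integrable_EFinZ _ _ R mu2 E mE).
by apply: ae2_impl ff' => x /[apply]; rewrite mulN1r addrC subr_ge0.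
Qed.

Lemma stiffness_ge0 E k u : fin_open E -> bounded_field E k ->
  {ae mu2, forall x, E x -> forall xi, 0 <= dot (mxact (k x) xi) xi} -> H1 E u ->
  0 <= stiffness k E u u.
Proof.
move=> fE bk k0 Hu; have mE := fin_open_measurable fE.
apply: Rintegral2_ae_ge0 => //; first exact: measurable_stiffness.
by apply: ae2_impl k0 => x /[apply].
Qed.

Lemma mxact1 (v : R2) : mxact 1%:M v = v.
Proof.
case: v => a b; rewrite /mxact !mxE/= !mulr1n !mulr0n.
by rewrite !mul1r !mul0r addr0 add0r.
Qed.

(** Reduces the gradient part of the coupling form to a stiffness with identity matrix, so that the
    lemmas on [stiffness] cover it too. *)
Lemma H1_dotE E u v : fin_open E -> H1 E u -> H1 E v ->
  H1_dot E u v = stiffness (fun=> 1%:M) E u v + \int[mu2]_(x in E) (u x * v x).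
Proof.
move=> fE Hu Hv; have mE := fin_open_measurable fE.
rewrite /H1_dot /stiffness -[X in X + _]mul1r -Rintegral2_lin//.
- by apply: eq_Rintegral => x _; rewrite mxact1 mul1r.
- exact: integrable_stiffness (bounded_field_cst _ _) _ _.
- by apply: integrable_L2M => //; [case: Hu|case: Hv].
Qed.

Lemma H1_dot_linl E (r : R) u v w : fin_open E -> H1 E u -> H1 E v -> H1 E w ->
  H1_dot E (fun x => r * u x + v x) w = r * H1_dot E u w + H1_dot E v w.
Proof.
move=> fE Hu Hv Hw; have mE := fin_open_measurable fE.
rewrite !H1_dotE//; last exact: H1_lin.
rewrite stiffness_linl//; last exact: bounded_field_cst.
have [[Lu _] [Lv _] [Lw _]] := And3 Hu Hv Hw.
have -> : \int[mu2]_(x in E) ((r * u x + v x) * w x) =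
    r * (\int[mu2]_(x in E) (u x * w x)) + \int[mu2]_(x in E) (v x * w x).
  rewrite -Rintegral2_lin//; try exact: integrable_L2M.
  by apply: eq_Rintegral => x _; rewrite mulrDl mulrA.
have alg (a b c d : R) : r * a + b + (r * c + d) = r * (a + c) + (b + d) by ring.
exact: alg.
Qed.

Lemma H1_dot_sym E u v : H1_dot E u v = H1_dot E v u.
Proof.
apply: eq_Rintegral => x _; move: (grad E u x) (grad E v x) => a b.
by rewrite /dot [a.1 * _]mulrC [a.2 * _]mulrC [u x * _]mulrC.
Qed.

Lemma H1_dot_eq0 E u w : fin_open E -> H1 E u -> H1 E w ->
  (forall x, E x -> u x = 0) -> H1_dot E u w = 0.
Proof.
move=> fE Hu Hw u0; have mE := fin_open_measurable fE.
rewrite H1_dotE// stiffness_eq0//; last exact: bounded_field_cst.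
rewrite add0r; transitivity (\int[mu2]_(x in E) (0 : R)).
  by apply: eq_Rintegral => x /set_mem/u0 ->; rewrite mul0r.
by rewrite Rintegral_cst// mul0r.
Qed.

End Forms.

(** * Symmetric linear systems *)

Section RowBasis.
Local Close Scope classical_set_scope.
(** Take a linearly independent family in S of maximal length; a member of S outside its row space
    could be stacked on top and would make it longer. *)
Lemma row_basis (F : fieldType) n (S : 'rV[F]_n -> Prop) :
  exists m (A : 'M[F]_(m, n)), (forall i, S (row i A)) /\
    (forall s, S s -> (s <= A)%MS).
Proof.
pose P m := `[< exists A : 'M[F]_(m, n), row_free A /\ (forall i, S (row i A)) >].
have P0 : exists m : nat, P m.
  exists 0; apply/asboolP; exists 0; split; last by case.
  by rewrite /row_free mxrank0.
have Pn m : P m -> (m <= n)%N.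
  by move=> /asboolP[A [/eqP rA _]]; rewrite -rA rank_leq_col.
case: (ex_maxnP P0 Pn) => m /asboolP[A [fA SA]] mmax; exists m, A; split=> // s Ss.
apply/negPn/negP => sA; suff /mmax : P m.+1 by rewrite ltnn.
rewrite -add1n; apply/asboolP; exists (col_mx s A); split.
  rewrite /row_free -addsmxE.
  have s0 : s != 0 by apply: contraNneq sA => ->; exact: sub0mx.
  have sI : (s :&: A)%MS = 0.
    apply/eqP; rewrite -submx0; apply/rV_subP => v; rewrite sub_capmx.
    move=> /andP[/sub_rVP[a ->] aA]; have [->|a0] := eqVneq a 0.
      by rewrite scale0r sub0mx.
    by move: sA; rewrite -(eqmx_scale _ a0) aA.
  rewrite mxrank_disjoint_sum// rank_rV s0 eqn_add2l; exact: fA.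
move=> i; case: (splitP i) => j ij.
  rewrite (_ : i = lshift m j); last exact/val_inj.
  by rewrite rowKu row_id // (ord1 j).
by rewrite (_ : i = rshift 1 j) ?rowKd//; exact/val_inj.
Qed.
End RowBasis.

Section SymmetricSystem.
Variables (R : fieldType) (Y : lmodType R) (n : nat).
Variables (S : Y -> Prop) (B : Y -> Y -> R) (iota : {linear Y -> 'rV[R]_n}).
Variable F : Y -> R.
Hypothesis S0 : S 0.
Hypothesis Slin : forall r x y, S x -> S y -> S (r *: x + y).
Hypothesis Blin : forall r x y z, S x -> S y -> S z ->
  B (r *: x + y) z = r * B x z + B y z.
Hypothesis Bsym : forall x y, S x -> S y -> B x y = B y x.
Hypothesis Biota : forall x y, S x -> S y -> iota x = 0 -> B x y = 0.
Hypothesis Flin : forall r x y, S x -> S y -> F (r *: x + y) = r * F x + F y.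
Hypothesis Fker : forall x, S x -> (forall y, S y -> B x y = 0) -> F x = 0.

Let sub_sum (I : finType) (s : I -> Y) (a : I -> R) :
  (forall i, S (s i)) -> S (\sum_i a i *: s i).
Proof.
move=> Ss; apply: big_ind => // [x y Sx Sy|i _].
  by rewrite -[x]scale1r; exact: Slin.
by rewrite -[_ *: _]addr0; exact: Slin.
Qed.

Let lin0 (G : Y -> R) : (forall r x y, S x -> S y -> G (r *: x + y) = r * G x + G y) ->
  G 0 = 0.
Proof.
move=> Gl; have := Gl 1 0 0 S0 S0; rewrite scaler0 addr0 mul1r => /eqP.
by rewrite -subr_eq subrr eq_sym => /eqP.
Qed.

Let lin_sum (G : Y -> R) (I : finType) (s : I -> Y) (a : I -> R) :
  (forall r x y, S x -> S y -> G (r *: x + y) = r * G x + G y) ->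
  (forall i, S (s i)) -> G (\sum_i a i *: s i) = \sum_i a i * G (s i).
Proof.
move=> Gl Ss.
suff : S (\sum_i a i *: s i) /\ G (\sum_i a i *: s i) = \sum_i a i * G (s i) by case.
apply: (big_ind2 (fun x g => S x /\ G x = g)) => [|x x' y y' [Sx ex] [Sy ey]|i _].
- by split=> //; exact: lin0.
- rewrite -[x]scale1r; split; first exact: Slin.
  by rewrite Gl// mul1r ex ey.
- rewrite -[_ *: _]addr0; split; first exact: Slin.
by rewrite Gl// (lin0 Gl) addr0.
Qed.

(** A Fredholm alternative. Since B vanishes where [iota] does, finitely many elements of S whose
    images span those of S carry all of B, and solvability becomes membership in the row space of
    their Gram matrix. *)
Lemma symmetric_system_solvable :
  exists x, S x /\ forall y, S y -> B x y = F y.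
Proof.
have [m [A [SA spanA]]] := row_basis (fun c => exists2 x, S x & iota x = c).
have SA' i : exists x, S x /\ iota x = row i A by have [x Sx xA] := SA i; exists x.
have [s /all_and2[Ss sA]] := choice SA'.
(* An element differs from a combination of the [s i] by something that [iota] kills. B does not see
   that remainder, and by [Fker] neither does F. *)
have span x : S x -> exists a : 'I_m -> R,
    (forall z, S z -> B x z = B (\sum_i a i *: s i) z) /\ F x = F (\sum_i a i *: s i).
  move=> Sx; have /submxP[c cx] := spanA _ (ex_intro2 _ _ _ Sx erefl).
  exists (fun i => c 0 i); set y := \sum_i _.
  have Sy : S y by exact: sub_sum.
  have Sd : S (-1 *: y + x) by exact: Slin.
  have d0 : iota (-1 *: y + x) = 0.
    rewrite linearP/= linear_sum/= scaleN1r cx mulmx_sum_row.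
    by under eq_bigr => i _ do rewrite linearZ/= sA; rewrite addNr.
  have Bd z : S z -> B (-1 *: y + x) z = 0 by move=> Sz; exact: Biota.
  have Fd := Fker Sd Bd.
  split=> [z Sz|]; apply/eqP; rewrite -subr_eq0.
    by rewrite -(Bd z Sz) Blin// mulN1r addrC.
  by rewrite -Fd Flin// mulN1r addrC.
pose M : 'M[R]_m := \matrix_(i, j) B (s i) (s j).
pose b : 'rV[R]_m := \row_j F (s j).
have Bs x y : S x -> S y -> (forall j, B x (s j) = F (s j)) -> B x y = F y.
  move=> Sx Sy h; have [a [Ba Fa]] := span y Sy.
  rewrite Bsym// Ba// Fa (lin_sum (G := F))// (lin_sum (G := B^~ x))//.
    by apply: eq_bigr => i _; rewrite Bsym// h.
  by move=> *; exact: Blin.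
(* The row b lies in the row space of M when it annihilates the cokernel. Each column of the
   cokernel lists the coefficients of an element in the kernel of B, where F vanishes. *)
have /submxP[c bc] : (b <= M)%MS.
  rewrite submxE; apply/eqP/matrixP => i j; rewrite mxE [RHS]mxE.
  pose a l := cokermx M l j; have Sa := sub_sum a Ss.
  transitivity (F (\sum_l a l *: s l)).
    rewrite (lin_sum (G := F))//; by apply: eq_bigr => l _; rewrite /b mxE mulrC.
  apply: Fker => // y Sy; have [a' [Ba' _]] := span y Sy.
  rewrite Bsym// Ba'// (lin_sum (G := B^~ _))//; last by move=> *; exact: Blin.
  rewrite big1// => p _; rewrite Bsym//; rewrite (lin_sum (G := B^~ _))//; last first.
    by move=> *; exact: Blin.
  have /matrixP/(_ p j) := mulmx_coker M; rewrite mxE [RHS]mxE => Mp.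
  rewrite (_ : \sum_i0 _ = 0) ?mulr0// -[RHS]Mp; apply: eq_bigr => l _.
  by rewrite /M mxE Bsym// mulrC.
exists (\sum_i c 0 i *: s i); have Sc := sub_sum (fun i => c 0 i) Ss.
split=> // y Sy; apply: Bs => // j.
rewrite (lin_sum (G := B^~ _))//; last by move=> *; exact: Blin.
have /matrixP/(_ 0 j) := bc; rewrite /b mxE [RHS]mxE => ->.
by apply: eq_bigr => i _; rewrite /M mxE.
Qed.

End SymmetricSystem.

(** * Semidefinite saddle point problems *)

Section SaddlePoint.
Variables (R : realFieldType) (V W : lmodType R) (n : nat).
Variables (P P0 : V -> Prop) (Q : W -> Prop).
Variables (a : V -> V -> R) (b : V -> W -> R) (iota : {linear (V * W)%type -> 'rV[R]_n}).
Hypothesis P0P : forall x, P0 x -> P x.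
Hypothesis P00 : P0 0.
Hypothesis Q0 : Q 0.
Hypothesis Plin : forall r x y, P x -> P y -> P (r *: x + y).
Hypothesis P0lin : forall r x y, P0 x -> P0 y -> P0 (r *: x + y).
Hypothesis Qlin : forall r x y, Q x -> Q y -> Q (r *: x + y).
Hypothesis alin : forall r x y z, P x -> P y -> P z ->
  a (r *: x + y) z = r * a x z + a y z.
Hypothesis asym : forall x y, P x -> P y -> a x y = a y x.
Hypothesis age0 : forall x, P x -> 0 <= a x x.
Hypothesis blinl : forall r x y w, P x -> P y -> Q w ->
  b (r *: x + y) w = r * b x w + b y w.
Hypothesis blinr : forall r x w w', P x -> Q w -> Q w' ->
  b x (r *: w + w') = r * b x w + b x w'.
Hypothesis a_iota : forall x w y, P0 x -> Q w -> P0 y -> iota (x, w) = 0 -> a x y = 0.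
Hypothesis b_iotal : forall x w w', P0 x -> Q w -> Q w' -> iota (x, w) = 0 -> b x w' = 0.
Hypothesis b_iotar : forall x w y, P0 x -> Q w -> P0 y -> iota (x, w) = 0 -> b y w = 0.

Lemma linear_at0 (U : lmodType R) (K : U -> Prop) (f : U -> R) : K 0 ->
  (forall r x y, K x -> K y -> f (r *: x + y) = r * f x + f y) -> f 0 = 0.
Proof.
move=> K0 fl; have := fl 1 0 0 K0 K0; rewrite scaler0 addr0 mul1r => /eqP.
by rewrite -subr_eq subrr eq_sym => /eqP.
Qed.

(** The degenerate case of Cauchy-Schwarz: with a x x = 0, the energy of t z + x is a quadratic in t
    without constant term, and it stays nonnegative only if its linear term vanishes. *)
Lemma semidefinite_kernel x z : P x -> P z -> a x x = 0 -> a z x = 0.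
Proof.
move=> Px Pz xx; pose c := a z z; pose d := a z x.
have key (t : R) : 0 <= t ^+ 2 * c + t *+ 2 * d.
  have := age0 (Plin t Pz Px).
  rewrite alin//; last exact: Plin.
  rewrite (asym Pz); last exact: Plin.
  rewrite (asym Px); last exact: Plin.
  rewrite !alin// (asym Px Pz) xx -/c -/d; congr (0 <= _).
  by rewrite mulr2n; ring.
have c0 : 0 <= c := age0 Pz.
have c1 : c + 1 != 0 by rewrite gt_eqF// ltr_wpDl.
(* The minimizer of the quadratic would be - d / c; the denominator c + 1 also covers c = 0 and
   still gives a negative value unless d = 0. *)
have := key (- d / (c + 1)).
rewrite (_ : _ + _ = - (d ^+ 2 * (c + 2)) / (c + 1) ^+ 2); last by field.
rewrite mulNr oppr_ge0 pmulr_lle0; last by rewrite invr_gt0 exprn_even_gt0.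
rewrite pmulr_lle0; last by rewrite ltr_wpDl.
by move=> d0; apply/eqP; rewrite -sqrf_eq0 eq_le d0 sqr_ge0.
Qed.

(** Both equations are one problem on pairs for a symmetric, indefinite form B, with the lifting z
    moved to the right-hand side. *)
Lemma saddle_point_solvable z : P z ->
  exists x w, [/\ P0 x, Q w,
    forall y, P0 y -> a (z + x) y + b y w = 0 &
    forall w', Q w' -> b x w' = 0].
Proof.
move=> Pz; have P0' : P 0 by exact: P0P.
have a0r x : P x -> a x 0 = 0.
  move=> Px; rewrite asym//; apply: (linear_at0 (K := P) (f := a^~ x)) => // *.
  exact: alin.
have b0r x : P x -> b x 0 = 0.
  by move=> Px; apply: (linear_at0 (K := Q) (f := b x)) => // *; exact: blinr.
have b0l w : Q w -> b 0 w = 0.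
  by move=> Qw; apply: (linear_at0 (K := P) (f := b^~ w)) => // *; exact: blinl.
pose B (x y : V * W) := a x.1 y.1 + b x.1 y.2 + b y.1 x.2.
have [|||||||[x w] [/= [P0x Qw] Bx]] := @symmetric_system_solvable R (V * W)%type n
  (fun x => P0 x.1 /\ Q x.2) B iota (fun y => - a z y.1).
- by split.
- by move=> r [x w] [y w'] [/= Px Qw] [Py Qw']; split; [exact: P0lin|exact: Qlin].
- move=> r [x w] [y w'] [u v] [/= /P0P Px Qw] [/P0P Py Qw'] [/P0P Pu Qv].
  by rewrite /B/= alin// blinl// blinr//; ring.
- move=> [x w] [y w'] [/= /P0P Px Qw] [/P0P Py Qw'].
  by rewrite /B/= asym// addrAC.
- move=> [x w] [y w'] [/= Px Qw] [Py Qw'] i0.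
  by rewrite /B/= (a_iota Px Qw Py i0) (b_iotal Px Qw Qw' i0) (b_iotar Px Qw Py i0) !addr0.
- move=> r [x w] [y w'] [/= /P0P Px Qw] [/P0P Py Qw'].
  have Pl : P (r *: x + y) by exact: Plin.
  by rewrite !(asym Pz)// alin// opprD mulrN.
(* Compatibility of the right-hand side: testing a kernel pair (x, w) with (0, w') gives b x w' = 0,
   then testing with (x, 0) leaves a x x = 0, hence a z x = 0. *)
- move=> [x w] [/= P0x Qw] Bx; have Px := P0P P0x.
  apply/eqP; rewrite oppr_eq0; apply/eqP; apply: semidefinite_kernel => //.
  have bx w' : Q w' -> b x w' = 0.
    move=> Qw'; have := Bx (0, w') (conj P00 Qw').
    by rewrite /B/= a0r// b0l// addr0 add0r.
  have := Bx (x, 0) (conj P0x Q0).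
  by rewrite /B/= b0r// bx// !addr0.
exists x, w; have Px := P0P P0x; split=> //.
  move=> y P0y; have Py := P0P P0y; have := Bx (y, 0) (conj P0y Q0).
  rewrite /B/= b0r// addr0 => e.
  by rewrite -[z]scale1r alin// mul1r -addrA e addrN.
move=> w' Qw'; have := Bx (0, w') (conj P00 Qw').
by rewrite /B/= !a0r// b0l// oppr0 addr0 add0r.
Qed.

End SaddlePoint.

(** * Geometry of the domains *)

Section Geometry.
Variable R : realType.
Local Notation R2 := (R * R)%type.
Local Notation mu2 := (leb2 R).
Implicit Types (a b Lf Lc L : R) (x : R2).

Lemma osquareP a x : osquare a x <-> `|x.1| < a /\ `|x.2| < a.
Proof. by rewrite /osquare/= !in_itv/= -!ltr_norml. Qed.

Lemma csquareP a x : csquare a x <-> `|x.1| <= a /\ `|x.2| <= a.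
Proof. by rewrite /csquare/= !in_itv/= -!ler_norml. Qed.

Lemma osquare_csquare a : osquare a `<=` csquare a.
Proof. by move=> x /osquareP[/ltW ? /ltW ?]; apply/csquareP. Qed.

Lemma csquare_osquare a b : a < b -> csquare a `<=` osquare b.
Proof.
by move=> ab x /csquareP[? ?]; apply/osquareP; split; exact: le_lt_trans ab.
Qed.

Lemma open_osquare a : open (osquare a).
Proof.
rewrite /osquare -[_ `*` _]/(fst @^-1` _ `&` snd @^-1` _).
by apply: openI; apply: open_comp => //; do ?exact: interval_open;
  move=> x _; [exact: cvg_fst|exact: cvg_snd].
Qed.

Lemma closed_csquare a : closed (csquare a).
Proof.
apply: compact_closed; first exact: norm_hausdorff.
by apply: compact_setX; exact: segment_compact.
Qed.

Lemma closure_osquare a : 0 < a -> closure (osquare a) = csquare a.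
Proof.
move=> a0; apply/seteqP; split.
  have /closure_id -> := @closed_csquare a.
  by apply: closure_subset; exact: osquare_csquare.
move=> x /csquareP[x1 x2] B /nbhs_ballP[e /= e0 xB].
(* Scaling x by 1 - s moves it into the open square; each coordinate moves by at most s a <= e / 2,
   so it stays within e of x. *)
pose s := Num.min 1 (e / (2 * a)).
have s0 : 0 < s by rewrite lt_min ltr01 divr_gt0// mulr_gt0.
have s1 : s <= 1 by rewrite ge_min lexx.
have sa : s * a < e.
  apply: (@le_lt_trans _ _ (e / 2)); last by lra.
  rewrite -ler_pdivlMr// (le_trans (_ : s <= e / (2 * a))) ?ge_min ?lexx ?orbT//.
  by rewrite invfM mulrA.
have shrink (t : R) : `|t| <= a -> `|(1 - s) * t| < a /\ `|t - (1 - s) * t| < e.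
  move=> ta; have t0 := normr_ge0 t; split.
    by rewrite normrM ger0_norm ?subr_ge0//; nra.
  have -> : t - (1 - s) * t = s * t by ring.
  by rewrite normrM gtr0_norm//; nra.
have [h1 h2] := shrink _ x1; have [h3 h4] := shrink _ x2.
by exists ((1 - s) * x.1, (1 - s) * x.2); split; [exact/osquareP|exact: xB].
Qed.

Lemma frontier_osquare a : 0 < a -> frontier (osquare a) = csquare a `\` osquare a.
Proof.
move=> a0; rewrite /frontier closure_osquare// (interior_id _).1//.
exact: open_osquare.
Qed.

Lemma osquare_finite a : (mu2 (osquare a) < +oo)%E.
Proof.
rewrite /osquare product_measure1E; try exact: measurable_itv.
have fin : (lebesgue_measure ([set` `](- a)%R, a[%R] : set R) < +oo)%E.
  by rewrite lebesgue_measure_itv; case: ifP => _; rewrite ?ltry// -EFinB ltry.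
apply: lte_mul_pinfty; [exact: measure_ge0| |exact: fin].
by rewrite ge0_fin_numE; [exact: fin|exact: measure_ge0].
Qed.

Lemma fin_open_sub E a : open E -> E `<=` osquare a -> fin_open E.
Proof.
move=> oE Ea; split=> //; apply: le_lt_trans (osquare_finite a).
by apply: le_measure => //; rewrite inE; apply: open_measurable2 => //; exact: open_osquare.
Qed.

Lemma open_osquareD a b : open (osquare a `\` csquare b).
Proof. by apply: openI; [exact: open_osquare|exact/closed_openC/closed_csquare]. Qed.

(** Shows that adding the interface to the two pieces gives an open set, as the results on weak
    gradients require of the domain of [VH]. *)
Lemma interface_annulus Lf Lc L : 0 < Lf -> Lf < Lc -> Lc < L ->
  D Lc L `|` Dc Lf Lc `|` Gammac Lc = osquare L `\` csquare Lf.
Proof.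
move=> f0 fc cL; rewrite /Gammac frontier_osquare; last exact: lt_trans fc.
have h1 := csquare_osquare fc; have h2 := csquare_osquare cL.
have h3 := @osquare_csquare Lc; have h4 := @osquare_csquare Lf.
apply/seteqP; split => x.
  move=> [[[oL nc]|[oc nf]]|[cc no]]; split=> //.
  - by move=> /h1/h3.
  - by apply: h2; exact: h3.
  - exact: h2.
  - by move=> /h1.
move=> [oL nf]; have [cc|nc] := pselect (csquare Lc x); last by left; left.
by have [oc|no] := pselect (osquare Lc x); [left; right|right].
Qed.

Lemma interface_square Lf Lc : 0 < Lf -> Lf < Lc ->
  Dc Lf Lc `|` Df Lf `|` Gammaf Lf = osquare Lc.
Proof.
move=> f0 fc; rewrite /Gammaf frontier_osquare//.
have h1 := csquare_osquare fc; have h4 := @osquare_csquare Lf.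
apply/seteqP; split => x.
  by move=> [[[oc nf]//|/h4/h1//]|[/h1]].
move=> oc; have [cf|nf] := pselect (csquare Lf x); last by left; left.
by have [hf|no] := pselect (osquare Lf x); [left; right|right].
Qed.

End Geometry.

(** * Finite elements *)

Section FiniteElements.
Variable R : realType.
Local Notation R2 := (R * R)%type.
Local Notation triangle := {ffun 'I_3 -> R2}.
Implicit Types (U E : set R2) (T : seq triangle) (u v : R2 -> R).

Lemma affine_on_lin E (r : R) u v : affine_on E u -> affine_on E v ->
  affine_on E (fun x => r * u x + v x).
Proof.
move=> [a [b ua]] [a' [b' va']].
exists (r * a.1 + a'.1, r * a.2 + a'.2), (r * b + b') => x Ex.
by rewrite ua// va'// /dot/=; ring.
Qed.

Lemma fem_lin U T (r : R) u v : fin_open U -> fem U T u -> fem U T v ->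
  fem U T (fun x => r * u x + v x).
Proof.
move=> fU [Hu Tu] [Hv Tv]; split; first exact: H1_lin.
by move=> t tT tU; apply: affine_on_lin; [exact: Tu|exact: Tv].
Qed.

Lemma fem0 U T : fin_open U -> fem U T (fun=> 0).
Proof.
move=> fU; split; first exact: H1_0.
by move=> t _ _; exists (0, 0), 0 => x _; rewrite /dot/= !mul0r !addr0.
Qed.

(** Barycentric weights sum to 1, so an affine function takes at x the same weighted mean of its
    vertex values. *)
Lemma affine_vertices (t : triangle) v : affine_on (cell t) v ->
  (forall i, v (t i) = 0) -> forall x, cell t x -> v x = 0.
Proof.
move=> [a [b va]] v0.
have vertex i : cell t (t i).
  exists (fun j => (j == i)%:R); split.
  - by move=> j; exact: ler0n.
  - by move=> j; rewrite inE.
  - by rewrite (bigD1 i)//= eqxx big1 ?addr0// => j /negPf ->.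
  - by rewrite (bigD1 i)//= eqxx mul1r big1 ?addr0// => j /negPf ->; rewrite mul0r.
  - by rewrite (bigD1 i)//= eqxx mul1r big1 ?addr0// => j /negPf ->; rewrite mul0r.
move=> x xt; rewrite va// [dot a x]/dot; case: xt => w [_ _ w1 -> ->].
transitivity (\sum_i w i * (dot a (t i) + b)).
  rewrite /dot/= !mulr_sumr -big_split/= -[b in LHS]mul1r -w1 mulr_suml -big_split/=.
  by apply: eq_bigr => i _; ring.
by rewrite big1// => i _; rewrite -va// v0 mulr0.
Qed.

Lemma fem_vertices_eq0 U T E v : fem U T v ->
  (forall x, E x -> exists2 t, t \in T & cell t `<=` closure U /\ cell t x) ->
  (forall t i, t \in T -> v (t i) = 0) -> forall x, E x -> v x = 0.
Proof.
move=> [_ Tv] cov v0 x /cov[t tT [tU tx]].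
by apply: (affine_vertices (Tv t tT tU)) => // i; exact: v0.
Qed.

Lemma mesh_cover (A B U : set R2) T : mesh A B T -> A `|` B `<=` U ->
  forall x, (A `|` B) x -> exists2 t, t \in T & cell t `<=` closure U /\ cell t x.
Proof.
move=> [_ cov side _] ABU x ABx.
have : closure (A `|` B) x by exact: subset_closure.
rewrite -cov => -[t tT tx]; exists t => //; split=> // y ty.
by have [s|s] := side t tT; have := s y ty; apply: closure_subset;
  apply: subset_trans ABU; [left|right].
Qed.

(** [fem B T] constrains only triangles in the closure of B. A triangle through a point of B cannot
    lie in the closure of A, since B is a neighbourhood of that point disjoint from A. *)
Lemma mesh_cover_right (A B : set R2) T : mesh A B T -> open B ->
  (forall x, A x -> ~ B x) ->
  forall x, B x -> exists2 t, t \in T & cell t `<=` closure B /\ cell t x.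
Proof.
move=> [_ cov side _] oB dAB x Bx.
have : closure (A `|` B) x by apply: subset_closure; right.
rewrite -cov => -[t tT tx]; exists t => //; split=> //.
have [s|//] := side t tT.
have [y [Ay By]] := s x tx B (open_nbhs_nbhs (conj oB Bx)).
by have := dAB y Ay.
Qed.

End FiniteElements.

Section Problem.
Variable R : realType.
Local Notation R2 := (R * R)%type.
Local Notation mu2 := (leb2 R).
Variables Lf Lc L : R.
Hypotheses (hLf : 0 < Lf) (hLc : Lf < Lc) (hL : Lc < L).

Lemma fin_open_D : fin_open (D Lc L).
Proof. by apply: (@fin_open_sub _ _ L); [exact: open_osquareD|move=> x []]. Qed.

Lemma fin_open_Dc : fin_open (Dc Lf Lc).
Proof. by apply: (@fin_open_sub _ _ Lc); [exact: open_osquareD|move=> x []]. Qed.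

Lemma fin_open_Df : fin_open (Df Lf).
Proof. exact: (fin_open_sub (@open_osquare _ _) (@subset_refl _ _)). Qed.

Lemma fin_open_DDc : fin_open (D Lc L `|` Dc Lf Lc).
Proof.
apply: (@fin_open_sub _ _ L); first by apply: openU; exact: open_osquareD.
move=> x [[]//|[oc _]]; apply: (csquare_osquare hL); exact: osquare_csquare.
Qed.

Lemma fin_open_VH : fin_open (D Lc L `|` Dc Lf Lc `|` Gammac Lc).
Proof.
rewrite interface_annulus//.
by apply: (@fin_open_sub _ _ L); [exact: open_osquareD|move=> x []].
Qed.

Lemma fin_open_Vh : fin_open (Dc Lf Lc `|` Df Lf `|` Gammaf Lf).
Proof.
rewrite interface_square//.
exact: (fin_open_sub (@open_osquare _ _) (@subset_refl _ _)).
Qed.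

Lemma H1_VH U u : open U -> U `<=` D Lc L `|` Dc Lf Lc ->
  H1 (D Lc L `|` Dc Lf Lc `|` Gammac Lc) u -> H1 U u.
Proof.
move=> oU UD; apply: H1_sub => //; first by case: fin_open_VH.
by move=> x /UD; left.
Qed.

Lemma H1_Vh U u : open U -> U `<=` Dc Lf Lc `|` Df Lf ->
  H1 (Dc Lf Lc `|` Df Lf `|` Gammaf Lf) u -> H1 U u.
Proof.
move=> oU UD; apply: H1_sub => //; first by case: fin_open_Vh.
by move=> x /UD; left.
Qed.
End Problem.

(** * The oscillating coefficient *)

Section Coefficient.
Variable R : realType.
Local Notation R2 := (R * R)%type.
Local Notation mu2 := (leb2 R).
Implicit Types (E : set R2) (k : R2 -> 'M[R]_2).

Lemma dot_ge0 (v : R2) : 0 <= dot v v.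
Proof. by rewrite /dot -!expr2 addr_ge0 ?sqr_ge0. Qed.

Lemma enorm_sqr (v : R2) : enorm v ^+ 2 = dot v v.
Proof. by rewrite /enorm sqr_sqrtr ?dot_ge0. Qed.

Lemma normr1_enorm (v : R2) : `|v.1| <= enorm v.
Proof.
by rewrite /enorm -sqrtr_sqr ler_sqrt ?dot_ge0// /dot -!expr2 lerDl sqr_ge0.
Qed.

Lemma normr2_enorm (v : R2) : `|v.2| <= enorm v.
Proof.
by rewrite /enorm -sqrtr_sqr ler_sqrt ?dot_ge0// /dot -!expr2 lerDr sqr_ge0.
Qed.

Lemma enorm_e1 : enorm (e1 : R2) = 1.
Proof. by rewrite /enorm /dot/= mulr1 mulr0 addr0 sqrtr1. Qed.

Lemma enorm_e2 : enorm (e2 : R2) = 1.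
Proof. by rewrite /enorm /dot/= mulr1 mulr0 add0r sqrtr1. Qed.

Lemma ord2P (i : 'I_2) : i = 0 \/ i = 1.
Proof. by case: i => [[|[|//]] h]; [left|right]; exact/val_inj. Qed.

(** The columns of [k x] are its values on [e1] and [e2], so two null sets suffice to bound every
    entry by c2. *)
Lemma coefficient_bounded E k : coefficient E k -> bounded_field E k.
Proof.
move=> [mk _ [c1 [c2 [c10 c20 H]]]]; split=> //; exists c2 => i j.
have He1 := H e1; have He2 := H e2.
apply: ae2_impl (ae2_and He1 He2) => x [h1 h2] Ex.
have [_] := h1 Ex; have [_] := h2 Ex; rewrite enorm_e1 enorm_e2 mulr1.
rewrite /mxact/= !mulr0 !mulr1 !add0r !addr0 => h4 h3.
by have [-> | ->] := ord2P i; have [-> | ->] := ord2P j;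
  rewrite ?(le_trans (normr1_enorm _) h3) ?(le_trans (normr2_enorm _) h3)
          ?(le_trans (normr1_enorm _) h4) ?(le_trans (normr2_enorm _) h4).
Qed.

Lemma open_rat_point (O : set R2) : open O -> O !=set0 ->
  exists p q : rat, O (ratr p, ratr q).
Proof.
move=> oO [x Ox].
have [e /= e0 xO] : exists2 e : R, 0 < e & ball x e `<=` O.
  by have /nbhs_ballP[e] := open_nbhs_nbhs (conj oO Ox); exists e.
have [a1 a2] : (x.1 < x.1 + e) /\ (x.2 < x.2 + e) by split; lra.
have [p hp] := rat_in_itvoo a1; have [q hq] := rat_in_itvoo a2.
move: hp hq; rewrite !in_itv/= => /andP[p1 p2] /andP[q1 q2].
by exists p, q; apply: xO; split; rewrite /ball/= ltr_distlC; lra.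
Qed.

(** The directions where the form is negative make an open set, which would contain a rational point
    if it were nonempty. *)
Lemma quadratic_ge0 (A : 'M[R]_2) :
  (forall p q : rat, 0 <= dot (mxact A (ratr p, ratr q)) (ratr p, ratr q)) ->
  forall xi, 0 <= dot (mxact A xi) xi.
Proof.
move=> Apq xi; rewrite leNgt; apply/negP => xi0.
have cQ : continuous (fun v : R2 => dot (mxact A v) v).
  have c1 : continuous (fst : R2 -> R) by move=> ?; exact: cvg_fst.
  have c2 : continuous (snd : R2 -> R) by move=> ?; exact: cvg_snd.
  have cl (a b : R) : continuous (fun v : R2 => a * v.1 + b * v.2).
    by move=> v; apply: cvgD; apply: cvgM; try exact: cvg_cst; [exact: c1|exact: c2].
  move=> v; apply: cvgD; apply: cvgM; [exact: cl|exact: c1|exact: cl|exact: c2].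
have oO : open [set v : R2 | dot (mxact A v) v < 0].
  by apply: (open_comp (f := fun v : R2 => dot (mxact A v) v) (D := [set t : R | t < 0]));
    [move=> v _; exact: cQ|exact: open_lt].
have [p [q /=]] := open_rat_point oO (ex_intro _ xi xi0).
by rewrite ltNge Apq.
Qed.

(* The coercivity inequality holds a.e. for each fixed direction; countably
   many rational directions suffice. *)
Lemma coefficient_ge0 E k : coefficient E k ->
  {ae mu2, forall x, E x -> forall xi, 0 <= dot (mxact (k x) xi) xi}.
Proof.
move=> [_ _ [c1 [c2 [c10 c20 H]]]].
pose dir n : R2 := if unpickle n is Some pq then
  (ratr (pq : rat * rat).1, ratr pq.2) else 0.
have Hn n : {ae mu2, forall x, E x -> 0 <= dot (mxact (k x) (dir n)) (dir n)}.
  apply: ae2_impl (H (dir n)) => x /[apply] -[+ _]; apply: le_trans.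
  by rewrite mulr_ge0 ?sqr_ge0// ltW.
have : {ae mu2, forall x, forall n, E x -> 0 <= dot (mxact (k x) (dir n)) (dir n)}.
  apply: negligibleS (negligible_bigcup Hn) => x /= /existsNP[n hn].
  by exists n.
apply: ae2_impl => x h Ex; apply: quadratic_ge0 => p q.
by have := h (pickle (p, q)) Ex; rewrite /dir pickleK.
Qed.

Lemma coefficient_symmetric E k : coefficient E k ->
  {ae mu2, forall x, E x -> symmetric_mx (k x)}.
Proof. by case. Qed.

End Coefficient.

(** * The coupled problem *)

Section CoupledForms.
Variable R : realType.
Local Notation R2 := (R * R)%type.
Local Notation mu2 := (leb2 R).
Variables Lf Lc L : R.
Hypotheses (hLf : 0 < Lf) (hLc : Lf < Lc) (hL : Lc < L).
Local Notation DL := (D Lc L).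
Local Notation DcL := (Dc Lf Lc).
Local Notation DfL := (Df Lf).
Implicit Types (u v w : R2 -> R) (A : 'M[R]_2) (k : R2 -> 'M[R]_2).

Let fD : fin_open DL := fin_open_D Lc L.
Let fDc : fin_open DcL := fin_open_Dc Lf Lc.
Let fDf : fin_open DfL := fin_open_Df Lf.

(** Only the two restrictions are recorded, because [Abar] integrates over each piece with the
    gradient chosen on that piece. *)
Definition H1_D_Dc u : Prop := H1 DL u /\ H1 DcL u.
Definition H1_Dc_Df u : Prop := H1 DcL u /\ H1 DfL u.

Lemma mxact_scalar (a : R) (v : R2) : mxact a%:M v = (a * v.1, a * v.2).
Proof.
by rewrite /mxact !mxE/= !mulr1n !mulr0n !mul0r addr0 add0r.
Qed.

Lemma admissible_coercive (cm cp : R) A : admissible cm cp A ->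
  forall xi, cm * dot xi xi <= dot (mxact A xi) xi.
Proof.
move=> [_ lo _] xi; apply: le_trans (lo xi); rewrite mxact_scalar /dot/=.
by rewrite mulrDr !mulrA.
Qed.

Lemma bilinear_rearrange (r c a a' b b' : R) :
  r * a + a' + c * (r * b + b') = r * (a + c * b) + (a' + c * b').
Proof. by ring. Qed.

Lemma bilinear_rearrangel (r c a a' b b' : R) :
  c * (r * b + b') + (r * a + a') = r * (c * b + a) + (c * b' + a').
Proof. by ring. Qed.

Lemma Abar_lin A (r : R) u v w : H1_D_Dc u -> H1_D_Dc v -> H1_D_Dc w ->
  Abar Lf Lc L A (fun x => r * u x + v x) w =
  r * Abar Lf Lc L A u w + Abar Lf Lc L A v w.
Proof.
move=> [u1 u2] [v1 v2] [w1 w2]; rewrite /Abar.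
rewrite (stiffness_linl r fD (bounded_field_cst _ _) u1 v1 w1).
rewrite (stiffness_linl r fDc (bounded_field_cst _ _) u2 v2 w2).
exact: bilinear_rearrange.
Qed.

Lemma Abar_sym A u v : symmetric_mx A -> H1_D_Dc u -> H1_D_Dc v ->
  Abar Lf Lc L A u v = Abar Lf Lc L A v u.
Proof.
move=> sA [u1 u2] [v1 v2]; rewrite /Abar.
have sA' E : {ae mu2, forall x, E x -> symmetric_mx ((fun=> A) x)} by exact: aeW.
rewrite (stiffness_sym fD (bounded_field_cst _ _) (sA' _) u1 v1).
by rewrite (stiffness_sym fDc (bounded_field_cst _ _) (sA' _) u2 v2).
Qed.

Lemma Abar_eq0 A u w : H1_D_Dc u -> H1_D_Dc w ->
  (forall x, (DL `|` DcL) x -> u x = 0) -> Abar Lf Lc L A u w = 0.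
Proof.
move=> [u1 u2] [w1 w2] u0; rewrite /Abar.
rewrite (stiffness_eq0 fD (bounded_field_cst _ _) u1 w1); last by move=> x ?; apply: u0; left.
rewrite (stiffness_eq0 fDc (bounded_field_cst _ _) u2 w2); last first.
  by move=> x ?; apply: u0; right.
by rewrite mulr0 addr0.
Qed.

Lemma Abar_ge0 A u : (forall xi, 0 <= dot (mxact A xi) xi) -> H1_D_Dc u ->
  0 <= Abar Lf Lc L A u u.
Proof.
move=> A0 [? ?].
have h E : {ae mu2, forall x, E x -> forall xi, 0 <= dot (mxact ((fun=> A) x) xi) xi}.
  exact: aeW.
by rewrite addr_ge0// ?mulr_ge0 ?invr_ge0//; apply: stiffness_ge0 => //;
  exact: bounded_field_cst.
Qed.

Variable k : R2 -> 'M[R]_2.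
Hypothesis hk : coefficient (Omega L) k.

Let mOmega : measurable (Omega L : set R2).
Proof. by apply: open_measurable2; exact: open_osquare. Qed.

Let DcOmega : DcL `<=` Omega L.
Proof.
by move=> x [oc _]; apply: (csquare_osquare hL); exact: osquare_csquare.
Qed.

Let DfOmega : DfL `<=` Omega L.
Proof.
by move=> x oc; apply: (csquare_osquare (lt_trans hLc hL)); exact: osquare_csquare.
Qed.

Let kDc : bounded_field DcL k.
Proof. exact: bounded_field_sub DcOmega mOmega (coefficient_bounded hk). Qed.

Let kDf : bounded_field DfL k.
Proof. exact: bounded_field_sub DfOmega mOmega (coefficient_bounded hk). Qed.

Lemma Acheck_lin (r : R) u v w : H1_Dc_Df u -> H1_Dc_Df v -> H1_Dc_Df w ->
  Acheck Lf Lc k (fun x => r * u x + v x) w =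
  r * Acheck Lf Lc k u w + Acheck Lf Lc k v w.
Proof.
move=> [u1 u2] [v1 v2] [w1 w2]; rewrite /Acheck.
rewrite (stiffness_linl r fDc kDc u1 v1 w1) (stiffness_linl r fDf kDf u2 v2 w2).
exact: bilinear_rearrangel.
Qed.

Lemma Acheck_sym u v : H1_Dc_Df u -> H1_Dc_Df v ->
  Acheck Lf Lc k u v = Acheck Lf Lc k v u.
Proof.
move=> [u1 u2] [v1 v2]; rewrite /Acheck.
have ks E : E `<=` Omega L -> {ae mu2, forall x, E x -> symmetric_mx (k x)}.
  by move=> EO; apply: ae2_impl (coefficient_symmetric hk) => x kx /EO.
rewrite (stiffness_sym fDc kDc (ks _ DcOmega) u1 v1).
by rewrite (stiffness_sym fDf kDf (ks _ DfOmega) u2 v2).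
Qed.

Lemma Acheck_eq0 u w : H1_Dc_Df u -> H1_Dc_Df w ->
  (forall x, (DcL `|` DfL) x -> u x = 0) -> Acheck Lf Lc k u w = 0.
Proof.
move=> [u1 u2] [w1 w2] u0; rewrite /Acheck.
rewrite (stiffness_eq0 fDc kDc u1 w1); last by move=> x ?; apply: u0; left.
rewrite (stiffness_eq0 fDf kDf u2 w2); last by move=> x ?; apply: u0; right.
by rewrite mulr0 addr0.
Qed.

Lemma Acheck_ge0 u : H1_Dc_Df u -> 0 <= Acheck Lf Lc k u u.
Proof.
move=> [? ?]; rewrite addr_ge0// ?mulr_ge0 ?invr_ge0//; apply: stiffness_ge0 => //;
  apply: ae2_impl (coefficient_ge0 hk) => x kx Ex; apply: kx;
  [exact: DcOmega|exact: DfOmega].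
Qed.

Lemma C_lin (r : R) u v w : H1 DcL u -> H1 DcL v -> H1 DcL w ->
  C Lf Lc (fun x => r * u x + v x) w = r * C Lf Lc u w + C Lf Lc v w.
Proof. exact: H1_dot_linl. Qed.

Lemma C_sym u v : C Lf Lc u v = C Lf Lc v u.
Proof. exact: H1_dot_sym. Qed.

Lemma C_eq0 u w : H1 DcL u -> H1 DcL w -> (forall x, DcL x -> u x = 0) ->
  C Lf Lc u w = 0.
Proof. exact: H1_dot_eq0. Qed.

End CoupledForms.

(** * Vertex values as finitely many coordinates *)

Section DegreesOfFreedom.
Variables (R : realType) (TH Th : seq {ffun 'I_3 -> R * R}).
Local Notation R2 := (R * R)%type.
Local Notation fields := ((R2 -> R) * (R2 -> R) * ((R2 -> R) * 'rV[R]_2))%type.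

(** A shared vertex is counted once per triangle. The redundancy is harmless: the coordinates only
    have to be finite in number and linear, and to force the forms to vanish when they do. The last
    two are the coefficients of the enrichment. *)
Definition dof_index : finType :=
  ('I_(size TH) * 'I_3 + 'I_(size Th) * 'I_3 + ('I_(size TH) * 'I_3 + 'I_2))%type.

Definition dof (x : fields) (q : dof_index) : R :=
  match q with
  | inl (inl (i, j)) => x.1.1 (tnth (in_tuple TH) i j)
  | inl (inr (i, j)) => x.1.2 (tnth (in_tuple Th) i j)
  | inr (inl (i, j)) => x.2.1 (tnth (in_tuple TH) i j)
  | inr (inr j) => x.2.2 0 j
  end.

Definition dofs (x : fields) : 'rV[R]_#|dof_index| := \row_q dof x (enum_val q).

Lemma dofs_linear : linear dofs.
Proof.
move=> r x y; apply/rowP => q; rewrite !mxE.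
by case: (enum_val q) => [[[i j]|[i j]]|[[i j]|j]] //=; rewrite !mxE.
Qed.

HB.instance Definition _ :=
  GRing.isLinear.Build R fields 'rV[R]_#|dof_index| _ dofs dofs_linear.

Lemma dofs_eq0 x q : dofs x = 0 -> dof x q = 0.
Proof. by move=> /rowP/(_ (enum_rank q)); rewrite !mxE enum_rankK. Qed.

Lemma vertices_eq0 (T : seq {ffun 'I_3 -> R2}) (v : R2 -> R) :
  (forall (i : 'I_(size T)) j, v (tnth (in_tuple T) i j) = 0) ->
  forall t j, t \in T -> v (t j) = 0.
Proof. by move=> v0 t j /(tnthP (in_tuple T))[i ->]. Qed.

End DegreesOfFreedom.

(** * Solvability of the coupled problem *)

Section Existence.
Variable R : realType.
Local Notation R2 := (R * R)%type.
Variables Lf Lc L : R.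
Hypotheses (hLf : 0 < Lf) (hLc : Lf < Lc) (hL : Lc < L).
Variable k : R2 -> 'M[R]_2.
Hypothesis hk : coefficient (Omega L) k.
Variables TH Th : seq {ffun 'I_3 -> R2}.
Hypothesis hTH : mesh (D Lc L) (Dc Lf Lc) TH.
Hypothesis hTh : mesh (Dc Lf Lc) (Df Lf) Th.
Local Notation VH := (VH Lf Lc L TH).
Local Notation VH_0 := (VH_0 Lf Lc L TH).
Local Notation VH_DirBC := (VH_DirBC Lf Lc L TH).
Local Notation Vh := (Vh Lf Lc Th).
Local Notation WH := (WH Lf Lc TH).
Local Notation W_enrich := (W_enrich Lf Lc TH Th).
Local Notation DL := (D Lc L).
Local Notation DcL := (Dc Lf Lc).
Local Notation DfL := (Df Lf).

Lemma VH_H1 u : VH u -> H1_D_Dc Lf Lc L u.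
Proof.
by move=> [Hu _]; split; apply: H1_VH Hu => //; exact: open_osquareD.
Qed.

Lemma Vh_H1 u : Vh u -> H1_Dc_Df Lf Lc u.
Proof.
by move=> [Hu _]; split; apply: H1_Vh Hu => //;
  [exact: open_osquareD|exact: open_osquare].
Qed.

Lemma VH_lin r u v : VH u -> VH v -> VH (fun x => r * u x + v x).
Proof. by apply: fem_lin; exact: fin_open_VH. Qed.

Lemma Vh_lin r u v : Vh u -> Vh v -> Vh (fun x => r * u x + v x).
Proof. by apply: fem_lin; exact: fin_open_Vh. Qed.

Lemma VH_0_lin r u v : VH_0 u -> VH_0 v -> VH_0 (fun x => r * u x + v x).
Proof.
move=> [Hu u0] [Hv v0]; split; first exact: VH_lin.
by move=> x Gx; rewrite u0// v0// mulr0 addr0.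
Qed.

Lemma VH_0_0 : VH_0 (fun=> 0).
Proof. by split=> //; apply: fem0; exact: fin_open_VH. Qed.

Lemma Vh_0 : Vh (fun=> 0).
Proof. by apply: fem0; exact: fin_open_Vh. Qed.

(** Both outcomes of [xget] are in H^1: a solution of [is_psi0], or the default 0. *)
Lemma psi0_H1 j : H1 DcL (psi0 Lf Lc Th j).
Proof.
rewrite /psi0; case: xgetP => [psi _ [[]]//|_].
by apply: H1_0; exact: fin_open_Dc.
Qed.

(** A linear parametrization of [W_enrich] by a coarse function and two coefficients. It gives
    multipliers finitely many coordinates even if the same function has several representations. *)
Definition enrich (w : (R2 -> R) * 'rV[R]_2) : R2 -> R :=
  fun x => w.1 x + \sum_j w.2 0 j * psi0 Lf Lc Th j x.

Lemma enrich_H1 w : WH w.1 -> H1 DcL (enrich w).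
Proof.
move=> [Hw _]; have fDc := fin_open_Dc Lf Lc.
have -> : enrich w = fun x => w.2 0 0 * psi0 Lf Lc Th 0 x +
    (w.2 0 1 * psi0 Lf Lc Th 1 x + w.1 x).
  apply/funext => x; rewrite /enrich big_ord_recl big_ord1 addrC addrA.
  by rewrite (_ : lift ord0 ord0 = 1)//; exact/val_inj.
by do 2 (apply: H1_lin => //; first exact: psi0_H1).
Qed.

Lemma W_enrichP phi : W_enrich phi <-> exists2 w, WH w.1 & phi = enrich w.
Proof.
split=> [[w0 [a [Hw ->]]]|[w Hw ->]].
  exists (w0, \row_j a j) => //; apply/funext => x; rewrite /enrich/=; congr (_ + _).
  by apply: eq_bigr => j _; rewrite mxE.
by exists w.1, (fun j => w.2 0 j).
Qed.

(** The pair (u0, c0) carries the boundary values and already satisfies the coupling constraint, so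
    its correction solves a saddle point problem with homogeneous boundary and coupling conditions,
    for a the sum of the two energies and b the coupling of the difference. *)
Lemma coupled_solution_exists (cm cp : R) (kbar : 'M[R]_2) u0 c0 :
  0 <= cm -> admissible cm cp kbar -> VH_DirBC u0 -> Vh c0 ->
  (forall phi, W_enrich phi -> C Lf Lc (fun x => u0 x - c0 x) phi = 0) ->
  exists s, is_coupled_solution Lf Lc L TH Th k kbar s.
Proof.
move=> cm0 Ak [Hu0 bu0] Hc0 orth.
have Ak0 xi : 0 <= dot (mxact kbar xi) xi.
  by apply: le_trans (admissible_coercive Ak xi); rewrite mulr_ge0 ?dot_ge0.
have sk : symmetric_mx kbar by case: Ak.
pose P (x : (R2 -> R) * (R2 -> R)) := VH x.1 /\ Vh x.2.
pose P0 (x : (R2 -> R) * (R2 -> R)) := VH_0 x.1 /\ Vh x.2.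
pose Q (w : (R2 -> R) * 'rV[R]_2) := WH w.1.
pose a (x y : (R2 -> R) * (R2 -> R)) :=
  Abar Lf Lc L kbar x.1 y.1 + Acheck Lf Lc k x.2 y.2.
pose diff (x : (R2 -> R) * (R2 -> R)) : R2 -> R := fun p => x.1 p - x.2 p.
pose b (x : (R2 -> R) * (R2 -> R)) (w : (R2 -> R) * 'rV[R]_2) :=
  C Lf Lc (diff x) (enrich w).
have fDc := fin_open_Dc Lf Lc.
have diff_lin r x y : diff (r *: x + y) = fun p => r * diff x p + diff y p.
  apply/funext => p; rewrite -[LHS]/(r * x.1 p + y.1 p - (r * x.2 p + y.2 p)).
  by rewrite /diff; ring.
have diff_H1 x : P x -> H1 DcL (diff x).
  move=> [/VH_H1[_ h1] /Vh_H1[h2 _]].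
  rewrite (_ : diff x = fun p => -1 * x.2 p + x.1 p); first exact: H1_lin.
  by apply/funext => p; rewrite /diff mulN1r addrC.
have enrich_lin r w w' : enrich (r *: w + w') = fun p => r * enrich w p + enrich w' p.
  apply/funext => p; rewrite -[LHS]/(r * w.1 p + w'.1 p +
    \sum_j (r *: w.2 + w'.2) 0 j * psi0 Lf Lc Th j p).
  rewrite /enrich mulrDr addrACA mulr_sumr -big_split.
  by congr (_ + _); apply: eq_bigr => j _; rewrite !mxE /= mulrDl mulrA.
have P0P x : P0 x -> P x by move=> [[]].
have coverH := mesh_cover hTH (U := D Lc L `|` Dc Lf Lc `|` Gammac Lc) (@subsetUl _ _ _).
have coverh := mesh_cover hTh (U := Dc Lf Lc `|` Df Lf `|` Gammaf Lf) (@subsetUl _ _ _).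
(* Functions of [WH] are affine only on triangles in the closure of [DcL], so a point of [DcL] needs
   a triangle on that side. *)
have coverW : forall x, DcL x -> exists2 t, t \in TH & cell t `<=` closure DcL /\ cell t x.
  apply: (mesh_cover_right hTH); first by case: fDc.
  by move=> x [_ nc] [oc _]; apply: nc; exact: osquare_csquare.
have v1_eq0 x w : P0 x -> dofs TH Th (x, w) = 0 -> forall p, (DL `|` DcL) p -> x.1 p = 0.
  move=> [[Hx _] _] d0; apply: (fem_vertices_eq0 Hx coverH).
  by apply: vertices_eq0 => i j; exact: (dofs_eq0 (inl (inl (i, j))) d0).
have v2_eq0 x w : P0 x -> dofs TH Th (x, w) = 0 -> forall p, (DcL `|` DfL) p -> x.2 p = 0.
  move=> [_ Hx] d0; apply: (fem_vertices_eq0 Hx coverh).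
  by apply: vertices_eq0 => i j; exact: (dofs_eq0 (inl (inr (i, j))) d0).
have w_eq0 x w : Q w -> dofs TH Th (x, w) = 0 -> forall p, DcL p -> enrich w p = 0.
  move=> Hw d0 p Dp; rewrite /enrich (fem_vertices_eq0 Hw coverW)// ?add0r.
    rewrite big1// => j _.
    by rewrite (_ : w.2 0 j = 0) ?mul0r//; exact: (dofs_eq0 (inr (inr j)) d0).
  by apply: vertices_eq0 => i j; exact: (dofs_eq0 (inr (inl (i, j))) d0).
have Pz : P (u0, c0) by [].
have lin_sum2 (r p q p' q' : R) : r * p + p' + (r * q + q') = r * (p + q) + (p' + q').
  by ring.
have [|||||||||||||[v vc] [w [/= [P0v Pvc] Qw sol orth']]] :=
  @saddle_point_solvable R _ _ _ P P0 Q a b (dofs TH Th) P0P _ _ _ _ _ _ _ _ _ _ _ _ _ _ Pz.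
- by split; [exact: VH_0_0|exact: Vh_0].
- exact: fem0.
- by move=> r x y [x1 x2] [y1 y2]; split; [exact: VH_lin|exact: Vh_lin].
- by move=> r x y [x1 x2] [y1 y2]; split; [exact: VH_0_lin|exact: Vh_lin].
- by move=> r x y x1 y1; exact: fem_lin.
- move=> r x y z [/VH_H1 x1 /Vh_H1 x2] [/VH_H1 y1 /Vh_H1 y2] [/VH_H1 z1 /Vh_H1 z2].
  rewrite -[LHS]/(Abar Lf Lc L kbar (fun p => r * x.1 p + y.1 p) z.1 +
    Acheck Lf Lc k (fun p => r * x.2 p + y.2 p) z.2).
  rewrite (Abar_lin _ _ x1 y1 z1) (Acheck_lin hLc hL hk _ x2 y2 z2).
  exact: lin_sum2.
- move=> x y [/VH_H1 x1 /Vh_H1 x2] [/VH_H1 y1 /Vh_H1 y2].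
  by rewrite /a (Abar_sym sk x1 y1) (Acheck_sym hLc hL hk x2 y2).
- move=> x [/VH_H1 x1 /Vh_H1 x2].
  exact: addr_ge0 (Abar_ge0 Ak0 x1) (Acheck_ge0 hLc hL hk x2).
- move=> r x y w' /diff_H1 dx /diff_H1 dy /enrich_H1 ew.
  by rewrite /b diff_lin; exact: C_lin.
- move=> r x w' w'' /diff_H1 dx /enrich_H1 e' /enrich_H1 e''.
  rewrite /b enrich_lin ![C _ _ (diff x) _]C_sym; exact: C_lin.
- move=> x w' y Px Qw' /P0P[/VH_H1 y1 /Vh_H1 y2] d0.
  have [/VH_H1 x1 /Vh_H1 x2] := P0P _ Px.
  rewrite /a (Abar_eq0 _ x1 y1 (v1_eq0 _ _ Px d0)).
  by rewrite (Acheck_eq0 hLc hL hk x2 y2 (v2_eq0 _ _ Px d0)) addr0.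
- move=> x w' w'' Px Qw' /enrich_H1 e'' d0.
  apply: (C_eq0 (diff_H1 _ (P0P _ Px)) e'') => p Dp.
  rewrite /diff (v1_eq0 _ _ Px d0); last by right.
  by rewrite (v2_eq0 _ _ Px d0) ?subrr//; left.
- move=> x w' y Px Qw' Py d0; rewrite /b C_sym.
  apply: (C_eq0 (enrich_H1 Qw') (diff_H1 _ (P0P _ Py))) => p Dp.
  exact: (w_eq0 _ _ Qw' d0).
exists ((fun p => u0 p + v p), (fun p => c0 p + vc p), enrich w).
have [Hv bv] : VH_0 v := P0v.
have addE (f g : R2 -> R) : (fun p => f p + g p) = (fun p => 1 * f p + g p).
  by apply/funext => p; rewrite mul1r.
have Hu : VH (fun p => u0 p + v p) by rewrite addE; exact: VH_lin.
have Huc : Vh (fun p => c0 p + vc p) by rewrite addE; exact: Vh_lin.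
have ew := enrich_H1 Qw.
split.
- split; last by split=> //; apply/W_enrichP; exists w.
  by split=> // p Gp; rewrite bu0// bv// addr0.
(* The test pair (v', 0) isolates the first equation of the coupled problem. *)
- move=> v' Hv'.
  have : Abar Lf Lc L kbar (fun p => u0 p + v p) v' +
      Acheck Lf Lc k (fun p => c0 p + vc p) (fun=> 0) +
      C Lf Lc (fun p => v' p - 0) (enrich w) = 0 := sol (v', fun=> 0) (conj Hv' Vh_0).
  rewrite (Acheck_sym hLc hL hk (Vh_H1 Huc) (Vh_H1 Vh_0)).
  rewrite (Acheck_eq0 hLc hL hk (Vh_H1 Vh_0) (Vh_H1 Huc)); last by [].
  by under [fun p => v' p - 0]eq_fun do rewrite subr0; rewrite addr0.
(* The test pair (0, v') isolates the second one; its minus sign comes from the difference in the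
   coupling. *)
- move=> v' Hv'; have [dv' _] := Vh_H1 Hv'.
  have [_ d0] := VH_H1 (VH_0_0).1.
  have : Abar Lf Lc L kbar (fun p => u0 p + v p) (fun=> 0) +
      Acheck Lf Lc k (fun p => c0 p + vc p) v' +
      C Lf Lc (fun p => 0 - v' p) (enrich w) = 0 := sol (fun=> 0, v') (conj VH_0_0 Hv').
  rewrite (Abar_sym sk (VH_H1 Hu) (VH_H1 (VH_0_0).1)).
  rewrite (Abar_eq0 _ (VH_H1 (VH_0_0).1) (VH_H1 Hu)); last by [].
  have -> : (fun p => 0 - v' p) = fun p => -1 * v' p + 0.
    by apply/funext => p; rewrite mulN1r addrC.
  rewrite (C_lin (-1) dv' d0 ew) (C_eq0 d0 ew); last by [].
  by rewrite add0r addr0 mulN1r.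
move=> phi /W_enrichP[w' Qw' ->].
have -> : (fun x => u0 x + v x - (c0 x + vc x)) =
    fun p => 1 * (u0 p - c0 p) + (v p - vc p).
  by apply/funext => p; rewrite mul1r opprD addrACA.
have dv := diff_H1 (v, vc) (P0P (v, vc) (conj P0v Pvc)).
rewrite (C_lin 1 (diff_H1 (u0, c0) Pz) dv (enrich_H1 Qw')).
by rewrite orth ?mulr0 ?add0r; [exact: orth'|apply/W_enrichP; exists w'].
Qed.
End Existence.

(** * Energy estimates *)

Section EnergyEstimates.
Variable R : realType.
Local Notation R2 := (R * R)%type.
Local Notation mu2 := (leb2 R).
Implicit Types (E : set R2) (u v w : R2 -> R) (A : 'M[R]_2).

Definition dirichlet E u : R := stiffness (fun=> 1%:M) E u u.

Lemma dirichletE E u : dirichlet E u = \int[mu2]_(x in E) dot (grad E u x) (grad E u x).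
Proof. by apply: eq_Rintegral => x _; rewrite mxact1. Qed.

Lemma integrable_dirichlet E u : fin_open E -> H1 E u ->
  mu2.-integrable E (EFin \o (fun x => dot (grad E u x) (grad E u x))).
Proof.
move=> fE Hu; have Lg := L2v_grad Hu.
by apply: integrable_dot => //; exact: fin_open_measurable.
Qed.

Lemma dirichlet_ge0 E u : 0 <= dirichlet E u.
Proof. by rewrite dirichletE; apply: Rintegral_ge0 => x _; exact: dot_ge0. Qed.

(** Young's inequality d x y <= c/4 y^2 + d^2/c x^2 on each of the four entries; every component of
    g and of h occurs in two of them, whence the doubled constants. *)
Lemma dot_perturbation (c d : R) (A A' : 'M[R]_2) (g h : R2) : 0 < c ->
  (forall i j, `|A i j - A' i j| <= d) ->
  dot (mxact A g) h <=
  dot (mxact A' g) h + (c / 2 * dot h h + 2 * d ^+ 2 / c * dot g g).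
Proof.
move=> c0 AA'; case: g => g1 g2; case: h => h1 h2; rewrite /dot /mxact/=.
have d0 : 0 <= d by exact: le_trans (AA' 0 0).
have term i j (x y : R) : A i j * x * y <= A' i j * x * y + d * (`|x| * `|y|).
  rewrite -lerBlDl -mulrBl -mulrBl -mulrA (le_trans (ler_norm _))// normrM normrM.
  by rewrite ler_wpM2r// mulr_ge0.
have := term 0 0 g1 h1; have := term 0 1 g2 h1.
have := term 1 0 g1 h2; have := term 1 1 g2 h2.
have sq (x : R) : x * x = `|x| * `|x| by rewrite -!expr2 real_normK ?num_real.
rewrite (sq g1) (sq g2) (sq h1) (sq h2).
move: (A 0 0) (A 0 1) (A 1 0) (A 1 1) (A' 0 0) (A' 0 1) (A' 1 0) (A' 1 1).
move=> a1 a2 a3 a4 b1 b2 b3 b4.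
move: (normr_ge0 g1) (normr_ge0 g2) (normr_ge0 h1) (normr_ge0 h2).
move: `|g1| `|g2| `|h1| `|h2| => x1 x2 y1 y2 x10 x20 y10 y20 e1 e2 e3 e4.
have amgm (x y : R) : d * (x * y) <= c / 4 * (y * y) + d ^+ 2 / c * (x * x).
  have -> : c / 4 * (y * y) + d ^+ 2 / c * (x * x) =
      d * (x * y) + c / 4 * (y - 2 * d / c * x) ^+ 2.
    by field; rewrite gt_eqF.
  by rewrite lerDl mulr_ge0 ?sqr_ge0// divr_ge0// ltW.
have f1 := amgm x1 y1; have f2 := amgm x2 y1.
have f3 := amgm x1 y2; have f4 := amgm x2 y2.
rewrite -[2 * d ^+ 2 / c]mulrA; move: (d ^+ 2 / c) f1 f2 f3 f4 => q f1 f2 f3 f4.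
by rewrite !mulrDl; lra.
Qed.

Lemma stiffness_perturbation E (c d : R) A A' u v : fin_open E -> H1 E u -> H1 E v ->
  0 < c -> (forall i j, `|A i j - A' i j| <= d) ->
  stiffness (fun=> A) E u v <= stiffness (fun=> A') E u v +
    (c / 2 * dirichlet E v + 2 * d ^+ 2 / c * dirichlet E u).
Proof.
move=> fE Hu Hv c0 AA'; have mE := fin_open_measurable fE.
have iA := integrable_stiffness fE (bounded_field_cst E A) Hu Hv.
have iA' := integrable_stiffness fE (bounded_field_cst E A') Hu Hv.
have iu := integrable_dirichlet fE Hu; have iv := integrable_dirichlet fE Hv.
have iu' := @integrable_EFinZ _ _ R mu2 E mE (2 * d ^+ 2 / c) _ iu.
have iuv := @integrable_EFinD _ _ R mu2 E mE _ _
  (@integrable_EFinZ _ _ R mu2 E mE (c / 2) _ iv) iu'.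
have iall := @integrable_EFinD _ _ R mu2 E mE _ _
  (@integrable_EFinZ _ _ R mu2 E mE 1 _ iA') iuv.
rewrite !dirichletE -[X in _ + (_ + X)](@RintegralZl _ _ R mu2 E _ _ mE iu).
rewrite -(Rintegral2_lin _ mE iv iu') -[X in X + _]mul1r -(Rintegral2_lin _ mE iA' iuv).
apply: Rintegral2_ae_le => //; apply: aeW => x _.
by rewrite mul1r; exact: dot_perturbation.
Qed.

Lemma stiffness_coercive E (c : R) A u : fin_open E -> H1 E u ->
  (forall xi, c * dot xi xi <= dot (mxact A xi) xi) ->
  c * dirichlet E u <= stiffness (fun=> A) E u u.
Proof.
move=> fE Hu cA; have mE := fin_open_measurable fE.
have iu := integrable_dirichlet fE Hu.
rewrite dirichletE -(@RintegralZl _ _ R mu2 E _ _ mE iu).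
apply: Rintegral2_ae_le => //.
- exact: (@integrable_EFinZ _ _ R mu2 E mE).
- exact: integrable_stiffness (bounded_field_cst _ _) _ _.
- by apply: aeW => x _; exact: cA.
Qed.

(** The cost uses the gradient chosen on the union, the energy those chosen on the pieces; they
    agree almost everywhere on each piece. *)
Lemma dirichlet_setU E E' u : fin_open E -> fin_open E' -> fin_open (E `|` E') ->
  (forall x, E x -> ~ E' x) -> H1 (E `|` E') u ->
  dirichlet (E `|` E') u = dirichlet E u + dirichlet E' u.
Proof.
move=> fE fE' fU dis Hu; have mE := fin_open_measurable fE.
have mE' := fin_open_measurable fE'; have iU := integrable_dirichlet fU Hu.
have part F : fin_open F -> F `<=` E `|` E' ->
    \int[mu2]_(x in F) dot (grad (E `|` E') u x) (grad (E `|` E') u x) = dirichlet F u.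
  move=> fF FU; rewrite dirichletE; have mF := fin_open_measurable fF.
  have [oF _] := fF; have [oU _] := fU.
  apply: Rintegral2_ae_eq => //.
  - apply: measurable_funS (integrable_measurable iU) => //.
    exact: fin_open_measurable.
  - by apply: integrable_measurable; apply: integrable_dirichlet => //; exact: H1_sub Hu.
  - by apply: ae2_impl (grad_sub fF oU FU Hu) => x /[apply] ->.
rewrite -(part E)// -(part E')// dirichletE.
apply: (@Rintegral_setU _ _ R mu2 E E') => //.
by apply/eqP; rewrite -subset0 => x [/dis].
Qed.

(** Expanding the square leaves the term |h|^2 and a cross term that Young's inequality with weight
    t controls. The factors 1 match the shape produced by [grad_lin]. *)
Lemma distance_perturbation (t : R) (p g h : R2) : 0 < t ->
  `|enorm ((1 * g.1 + h.1, 1 * g.2 + h.2) - p) ^+ 2 - enorm (g - p) ^+ 2| <=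
  t * enorm (g - p) ^+ 2 + (1 + t^-1) * dot h h.
Proof.
move=> t0; rewrite !enorm_sqr; case: g => g1 g2; case: h => h1 h2; case: p => p1 p2.
have key (x y : R) : `|2 * (x * y)| <= t * (x * x) + t^-1 * (y * y).
  have t0' : t != 0 by rewrite gt_eqF.
  have p1' : t * (x * x) + t^-1 * (y * y) - 2 * (x * y) = t^-1 * (t * x - y) ^+ 2.
    by field.
  have p2' : t * (x * x) + t^-1 * (y * y) + 2 * (x * y) = t^-1 * (t * x + y) ^+ 2.
    by field.
  have ti : 0 <= t^-1 by rewrite invr_ge0 ltW.
  rewrite ler_norml; apply/andP; split.
    by rewrite lerNl -subr_ge0 opprK p2' mulr_ge0 ?sqr_ge0.
  by rewrite -subr_ge0 p1' mulr_ge0 ?sqr_ge0.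
rewrite /dot/=.
rewrite !mul1r ![_ + _ - p1]addrAC ![_ + _ - p2]addrAC.
move: (g1 - p1) (g2 - p2) => x1 x2.
have := key x1 h1; have := key x2 h2; rewrite !ler_norml.
move: t^-1 => q /andP[? ?] /andP[? ?]; apply/andP.
have := sqr_ge0 h1; have := sqr_ge0 h2; rewrite !expr2 => ? ?.
by split; lra.
Qed.

End EnergyEstimates.

(** * The cost as a functional of the coarse solution *)

Section Distance.
Variable R : realType.
Local Notation R2 := (R * R)%type.
Local Notation mu2 := (leb2 R).
Implicit Types (E : set R2) (u v : R2 -> R).

Definition gap E u : R := \int[mu2]_(x in E) enorm (grad E u x - e1) ^+ 2.

Lemma gap_ge0 E u : 0 <= gap E u.
Proof. by apply: Rintegral_ge0 => x _; exact: sqr_ge0. Qed.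

Lemma integrable_gap E u : fin_open E -> H1 E u ->
  mu2.-integrable E (EFin \o (fun x => enorm (grad E u x - e1) ^+ 2)).
Proof.
move=> fE Hu; have mE := fin_open_measurable fE; have [_ finE] := fE.
have [g1 g2] := L2v_grad Hu.
have Lc (r : R) : L2 E (fun=> r).
  by apply: (@L2_bounded _ _ _ `|r|) => //; exact: measurable_cst.
have Lg : L2v E (fun x => grad E u x - e1).
  split.
    have -> : (fun x => (grad E u x - e1).1) = fun x => -1 * 1 + (grad E u x).1.
      by apply/funext => x; rewrite mulr1 addrC.
    exact: L2_lin.
  have -> : (fun x => (grad E u x - e1).2) = fun x => -1 * 0 + (grad E u x).2.
    by apply/funext => x; rewrite mulr0 add0r -[LHS]/((grad E u x).2 - 0) subr0.
  exact: L2_lin.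
apply: eq_integrable (integrable_dot mE Lg Lg) => //.
by move=> x _ /=; rewrite enorm_sqr.
Qed.

Lemma gap_perturbation E (t : R) u u' : fin_open E -> H1 E u -> H1 E u' -> 0 < t ->
  `|gap E u' - gap E u| <=
  t * gap E u + (1 + t^-1) * dirichlet E (fun p => -1 * u p + u' p).
Proof.
move=> fE Hu Hu' t0; have mE := fin_open_measurable fE.
set e := fun p => _; have He : H1 E e by exact: H1_lin.
have u'E : u' = fun p => 1 * u p + e p.
  by apply/funext => p; rewrite /e mul1r mulN1r addrA subrr add0r.
have i1 := integrable_gap fE Hu; have i2 := integrable_gap fE Hu'.
have i3 := integrable_dirichlet fE He.
have i3' := @integrable_EFinZ _ _ R mu2 E mE (1 + t^-1) _ i3.
have i4 := @integrable_EFinD _ _ R mu2 E mE _ _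
  (@integrable_EFinZ _ _ R mu2 E mE t _ i1) i3'.
have gu' : {ae mu2, forall x, E x -> grad E u' x =
    (1 * (grad E u x).1 + (grad E e x).1, 1 * (grad E u x).2 + (grad E e x).2)}.
  by rewrite u'E; exact: grad_lin.
rewrite dirichletE -(@RintegralZl _ _ R mu2 E _ _ mE i3) /gap.
rewrite -(Rintegral2_lin t mE i1 i3').
have i5 (r : R) := @integrable_EFinD _ _ R mu2 E mE _ _
  (@integrable_EFinZ _ _ R mu2 E mE r _ i4) i1.
rewrite ler_norml lerBlDr lerBrDr; apply/andP; split.
  rewrite -[X in X + _]mulN1r -(Rintegral2_lin (-1) mE i4 i1).
  apply: (Rintegral2_ae_le mE (i5 (-1)) i2).
  apply: ae2_impl gu' => x /[apply] ->.
  have := distance_perturbation e1 (grad E u x) (grad E e x) t0.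
  by rewrite ler_norml mulN1r => /andP[+ _]; rewrite lerBrDr.
rewrite -[X in X + _]mul1r -(Rintegral2_lin 1 mE i4 i1).
apply: (Rintegral2_ae_le mE i2 (i5 1)).
apply: ae2_impl gu' => x /[apply] ->.
have := distance_perturbation e1 (grad E u x) (grad E e x) t0.
by rewrite ler_norml => /andP[_]; rewrite lerBlDr [X in _ -> _ <= X + _]mul1r.
Qed.

End Distance.

(** * Stability of the solution with respect to the matrix *)

Section Stability.
Variable R : realType.
Local Notation R2 := (R * R)%type.
Variables Lf Lc L : R.
Hypotheses (hLf : 0 < Lf) (hLc : Lf < Lc) (hL : Lc < L).
Variable k : R2 -> 'M[R]_2.
Hypothesis hk : coefficient (Omega L) k.
Variables TH Th : seq {ffun 'I_3 -> R2}.
Variables cm cp : R.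
Hypothesis hcm : 0 < cm.
Local Notation DL := (D Lc L).
Local Notation DcL := (Dc Lf Lc).

(** This is [Abar] for the identity matrix, whence the weight one half. *)
Definition energy (u : R2 -> R) : R := dirichlet DL u + 2^-1 * dirichlet DcL u.

Lemma energy_ge0 u : 0 <= energy u.
Proof. by rewrite addr_ge0 ?mulr_ge0 ?invr_ge0 ?dirichlet_ge0. Qed.

Lemma Abar_energy A u : admissible cm cp A -> H1_D_Dc Lf Lc L u ->
  cm * energy u <= Abar Lf Lc L A u u.
Proof.
move=> /admissible_coercive cA [u1 u2]; rewrite /energy /Abar mulrDr mulrCA.
apply: lerD; first exact: (stiffness_coercive (fin_open_D Lc L) u1 cA).
rewrite ler_wpM2l ?invr_ge0//.
exact: (stiffness_coercive (fin_open_Dc Lf Lc) u2 cA).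
Qed.

Lemma Abar_perturbation (A A' : 'M[R]_2) (d : R) u v :
  H1_D_Dc Lf Lc L u -> H1_D_Dc Lf Lc L v ->
  (forall i j, `|A i j - A' i j| <= d) ->
  Abar Lf Lc L A u v <=
  Abar Lf Lc L A' u v + (cm / 2 * energy v + 2 * d ^+ 2 / cm * energy u).
Proof.
move=> [u1 u2] [v1 v2] AA'.
have h1 := stiffness_perturbation (fin_open_D Lc L) u1 v1 hcm AA'.
have h2 := stiffness_perturbation (fin_open_Dc Lf Lc) u2 v2 hcm AA'.
rewrite /energy /Abar; move: h1 h2.
move: (stiffness _ DL u v) (stiffness _ DcL u v) => s1 s2.
move: (stiffness _ DL u v) (stiffness _ DcL u v) => s1' s2'.
move: (dirichlet DL u) (dirichlet DcL u) (dirichlet DL v) (dirichlet DcL v) => a1 a2 b1 b2.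
move: (2 * d ^+ 2 / cm) (cm / 2) => q r h1 h2.
have : 2^-1 * s2 <= 2^-1 * (s2' + (r * b2 + q * a2)) by rewrite ler_wpM2l ?invr_ge0.
lra.
Qed.

(* Both coupled problems are tested with the difference [e] of the solutions:
   the multipliers drop out, because [e] satisfies the coupling constraint. *)
Lemma energy_stability (A A' : 'M[R]_2) u uc psi u' uc' psi' (d : R) :
  admissible cm cp A -> admissible cm cp A' ->
  is_coupled_solution Lf Lc L TH Th k A (u, uc, psi) ->
  is_coupled_solution Lf Lc L TH Th k A' (u', uc', psi') ->
  (forall i j, `|A i j - A' i j| <= d) ->
  energy (fun p => -1 * u p + u' p) <= 4 * d ^+ 2 / cm ^+ 2 * energy u.
Proof.
move=> Ak Ak' [[[Vu bu] [Vuc Wp]] s1 s2 s3] [[[Vu' bu'] [Vuc' Wp']] s1' s2' s3'] AA'.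
pose e := fun p => -1 * u p + u' p; pose ec := fun p => -1 * uc p + uc' p.
have Ve : VH Lf Lc L TH e by exact: VH_lin.
have Vec : Vh Lf Lc Th ec by exact: Vh_lin.
have Ve0 : VH_0 Lf Lc L TH e.
  by split=> // x Gx; rewrite /e bu// bu'// mulN1r addNr.
have [Hu Hu' He] := And3 (VH_H1 hLf hLc hL Vu) (VH_H1 hLf hLc hL Vu') (VH_H1 hLf hLc hL Ve).
have [Huc Huc' Hec] := And3 (Vh_H1 hLf hLc Vuc) (Vh_H1 hLf hLc Vuc') (Vh_H1 hLf hLc Vec).
have [De Dec] : H1 DcL e /\ H1 DcL ec by case: He; case: Hec.
have fDc := fin_open_Dc Lf Lc.
have W_H1 phi : W_enrich Lf Lc TH Th phi -> H1 DcL phi.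
  by move=> /W_enrichP[w Hw ->]; exact: (enrich_H1 Th Hw).
have constraint phi : W_enrich Lf Lc TH Th phi -> C Lf Lc e phi = C Lf Lc ec phi.
  move=> Wphi; have Hphi := W_H1 _ Wphi.
  have split2 (f g : R2 -> R) : H1 DcL f -> H1 DcL g ->
      C Lf Lc (fun p => f p - g p) phi = C Lf Lc f phi - C Lf Lc g phi.
    move=> Hf Hg; rewrite (_ : (fun p => f p - g p) = fun p => -1 * g p + f p).
      by rewrite (C_lin (-1) Hg Hf Hphi) mulN1r addrC.
    by apply/funext => p; rewrite mulN1r addrC.
  have [_ hu] := Hu; have [_ hu'] := Hu'; have [huc _] := Huc; have [huc' _] := Huc'.
  rewrite (C_lin (-1) hu hu' Hphi) (C_lin (-1) huc huc' Hphi).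
  have := s3 _ Wphi; have := s3' _ Wphi.
  rewrite (split2 u uc hu huc) (split2 u' uc' hu' huc').
  by move=> /eqP; rewrite subr_eq0 => /eqP -> /eqP; rewrite subr_eq0 => /eqP ->.
have t1 := s1 _ Ve0; have t2 := s2 _ Vec; have t1' := s1' _ Ve0; have t2' := s2' _ Vec.
rewrite (constraint _ Wp) in t1; rewrite (constraint _ Wp') in t1'.
have ee : Abar Lf Lc L A' e e = -1 * Abar Lf Lc L A' u e + Abar Lf Lc L A' u' e.
  exact: Abar_lin.
have cc : Acheck Lf Lc k ec ec = -1 * Acheck Lf Lc k uc ec + Acheck Lf Lc k uc' ec.
  exact: (Acheck_lin hLc hL hk).
have c0 := Acheck_ge0 hLc hL hk Hec.
have low := Abar_energy Ak' He.
have up := Abar_perturbation Hu He AA'.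
rewrite -/e; move: t1 t2 t1' t2' ee cc c0 low up.
move: (Abar Lf Lc L A u e) (Abar Lf Lc L A' u e) (Abar Lf Lc L A' u' e).
move: (Abar Lf Lc L A' e e) (Acheck Lf Lc k ec ec) (Acheck Lf Lc k uc ec).
move: (Acheck Lf Lc k uc' ec) (C Lf Lc ec psi) (C Lf Lc ec psi') (energy e) (energy u).
move=> c1 m m' ge gu c2 c3 a1 a2 a3 a4 t1 t2 t1' t2' ee cc c0 low up.
(* The equations combine to Abar A' e e + Acheck ec ec = Abar A u e - Abar A' u e. The second energy
   is nonnegative, and half of the coercivity absorbs the energy of e on the right. *)
have : cm * ge <= cm / 2 * ge + 2 * d ^+ 2 / cm * gu by lra.
have -> : 4 * d ^+ 2 / cm ^+ 2 * gu = (2 * d ^+ 2 / cm * gu) / (cm / 2).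
  by field; rewrite gt_eqF.
move: (2 * d ^+ 2 / cm * gu) => q bound.
by rewrite ler_pdivlMr ?divr_gt0// mulrC; lra.
Qed.

End Stability.

(** * Minimization *)

Section Admissible.
Variable R : realType.
Local Notation R2 := (R * R)%type.
Local Notation R3 := (R * (R * R))%type.

Lemma minimizerP (T : Type) (f : T -> R) (A : set T) a : A a ->
  (forall b, A b -> f a <= f b) -> minimizer f A a.
Proof.
move=> Aa fa; split=> //; apply/eqP; rewrite eq_le; apply/andP; split.
  by apply: lb_le_inf; [exists (f a), a|move=> _ [b Ab <-]; exact: fa].
by apply: ge_inf; [exists (f a) => _ [b Ab <-]; exact: fa|exists a].
Qed.

(** Coordinates on symmetric matrices: in the product, compactness comes from segments, and a ball
    of radius d bounds every entry of the difference by d. *)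
Definition sym_mx (p : R3) : 'M[R]_2 :=
  \matrix_(i, j) if i == 0 then (if j == 0 then p.1 else p.2.1)
                 else (if j == 0 then p.2.1 else p.2.2).

Lemma sym_mxK A : symmetric_mx A -> sym_mx (A 0 0, (A 0 1, A 1 1)) = A.
Proof.
move=> /matrixP sA; apply/matrixP => i j; rewrite mxE.
have := sA 0 1; rewrite mxE => A10.
by have [-> | ->] := ord2P i; have [-> | ->] := ord2P j; rewrite //= A10.
Qed.

Lemma sym_mx_symmetric p : symmetric_mx (sym_mx p).
Proof.
apply/matrixP => i j; rewrite !mxE.
by have [-> | ->] := ord2P i; have [-> | ->] := ord2P j.
Qed.

Lemma sym_mx_dist (p q : R3) (d : R) : ball p d q ->
  forall i j, `|sym_mx p i j - sym_mx q i j| <= d.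
Proof.
move=> [b1 [b2 b3]] i j; rewrite !mxE; move: b1 b2 b3; rewrite /ball/= => b1 b2 b3.
by have [-> | ->] := ord2P i; have [-> | ->] := ord2P j => /=; exact: ltW.
Qed.

Definition quad (p : R3) (v : R2) : R :=
  (p.1 * v.1 + p.2.1 * v.2) * v.1 + (p.2.1 * v.1 + p.2.2 * v.2) * v.2.

Lemma quadE p v : dot (mxact (sym_mx p) v) v = quad p v.
Proof. by rewrite /dot /mxact/= !mxE. Qed.

Lemma quad_continuous v : continuous (quad ^~ v).
Proof.
have c1 : continuous (fun p : R3 => p.1) by move=> ?; exact: cvg_fst.
have c2 : continuous (fun p : R3 => p.2) by move=> ?; exact: cvg_snd.
have c21 : continuous (fun p : R3 => p.2.1).
  by move=> p; apply: (continuous_comp (c2 p)); exact: cvg_fst.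
have c22 : continuous (fun p : R3 => p.2.2).
  by move=> p; apply: (continuous_comp (c2 p)); exact: cvg_snd.
have cl (f g : R3 -> R) (a b : R) : continuous f -> continuous g ->
    continuous (fun p => f p * a + g p * b).
  by move=> cf cg p; apply: cvgD; apply: cvgM; try exact: cvg_cst; [exact: cf|exact: cg].
exact: cl (cl _ _ v.1 v.2 c1 c21) (cl _ _ v.1 v.2 c21 c22).
Qed.

Lemma admissible_sym_mxP (cm cp : R) p : admissible cm cp (sym_mx p) <->
  forall v, cm * dot v v <= quad p v <= cp * dot v v.
Proof.
have sc (c : R) (v : R2) : dot (mxact c%:M v) v = c * dot v v.
  by rewrite mxact_scalar /dot/= mulrDr !mulrA.
split=> [[_ lo up] v|h].
  by have := lo v; have := up v; rewrite quadE !sc => -> ->.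
split; [exact: sym_mx_symmetric|move=> v|move=> v];
  by have /andP[] := h v; rewrite quadE sc.
Qed.

Lemma admissible_compact (cm cp : R) : 0 < cm ->
  compact [set p | admissible cm cp (sym_mx p)].
Proof.
move=> cm0; apply: (@subclosed_compact _ _ (`[- cp, cp] `*` (`[- cp, cp] `*` `[- cp, cp]))).
- rewrite [X in closed X](_ : _ =
      \bigcap_(v in setT) ((quad ^~ v) @^-1` `[cm * dot v v, cp * dot v v])).
    apply: closed_bigI => v _; apply: preimage_closed; last exact: itv_closed.
    by move=> p _; exact: quad_continuous.
  apply/seteqP; split => p /=.
    by move=> /admissible_sym_mxP h v _; rewrite /= in_itv/=; exact: h.
  by move=> h; apply/admissible_sym_mxP => v; have := h v I; rewrite /= in_itv.
- by apply: compact_setX; [|apply: compact_setX]; exact: segment_compact.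
move=> [a [b c]] /= /admissible_sym_mxP h; rewrite !in_itv/=.
(* The coordinate directions bound the diagonal entries, which are positive; the two diagonal
   directions then bound the off-diagonal one. *)
have := h (1, 0); have := h (0, 1); have := h (1, 1); have := h (1, -1).
rewrite /quad /dot/= => /andP[x1 x2] /andP[y1 y2] /andP[z1 z2] /andP[w1 w2].
by split; [|split]; apply/andP; split; lra.
Qed.

Lemma scalar_admissible (cm cp : R) : cm < cp -> admissible cm cp (cm%:M : 'M[R]_2).
Proof.
move=> cmp; split; first exact: tr_scalar_mx.
  by move=> v.
move=> v; rewrite !mxact_scalar /dot/=.
by have := sqr_ge0 v.1; have := sqr_ge0 v.2; rewrite !expr2 => ? ?; nra.
Qed.

End Admissible.

(** * Continuity of the cost and existence of a minimizer *)

Section Minimum.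
Variable R : realType.
Local Notation R2 := (R * R)%type.
Variables Lf Lc L : R.
Hypotheses (hLf : 0 < Lf) (hLc : Lf < Lc) (hL : Lc < L).
Variable k : R2 -> 'M[R]_2.
Hypothesis hk : coefficient (Omega L) k.
Variables TH Th : seq {ffun 'I_3 -> R2}.
Variables cm cp : R.
Hypothesis hcm : 0 < cm.
Local Notation cost := (cost Lf Lc L TH Th k).
Local Notation solution := (coupled_solution Lf Lc L TH Th k).

Lemma add_le_double_half (a b : R) : 0 <= a -> a + b <= 2 * (a + 2^-1 * b).
Proof. by lra. Qed.

(** Origin of 16: a factor 2 undoes the half weight on [Dc], 4 comes from the energy estimate, and
    (1 + 1/d) d^2 = d (d + 1) <= 2 d. *)
Lemma perturbation_bound (d ge gu s : R) : ge <= 4 * d ^+ 2 / cm ^+ 2 * gu ->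
  s <= 2 * ge -> 0 < d -> d <= 1 -> 0 <= gu ->
  (1 + d^-1) * s <= d * (16 / cm ^+ 2 * gu).
Proof.
move=> stab low d0 d1 gu0.
have d1' : 0 <= 1 + d^-1 by rewrite addr_ge0// invr_ge0 ltW.
apply: (@le_trans _ _ ((1 + d^-1) * (2 * (4 * d ^+ 2 / cm ^+ 2 * gu)))).
  by rewrite ler_wpM2l// (le_trans low)// ler_wpM2l.
have -> : (1 + d^-1) * (2 * (4 * d ^+ 2 / cm ^+ 2 * gu)) =
    d * ((d + 1) * (8 / cm ^+ 2 * gu)).
  by field; rewrite !gt_eqF.
have -> : 16 / cm ^+ 2 * gu = 2 * (8 / cm ^+ 2 * gu) by ring.
apply: ler_wpM2l; first exact: ltW.
apply: ler_wpM2r; last by lra.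
by rewrite mulr_ge0// divr_ge0// exprn_ge0// ltW.
Qed.

(** Taking the Young weight equal to d balances the two errors. The bound involves the solution for
    A only, so no uniform estimate in A' has to be known for continuity at A. *)
Lemma cost_perturbation (A A' : 'M[R]_2) (d : R) :
  admissible cm cp A -> admissible cm cp A' ->
  is_coupled_solution Lf Lc L TH Th k A (solution A) ->
  is_coupled_solution Lf Lc L TH Th k A' (solution A') ->
  0 < d <= 1 -> (forall i j, `|A i j - A' i j| <= d) ->
  `|cost A' - cost A| <=
  d * (cost A + 16 / cm ^+ 2 * energy Lf Lc L (ubar Lf Lc L TH Th k A)).
Proof.
move=> Ak Ak'; rewrite /cost /ubar.
case: (solution A) => -[u uc] psi; case: (solution A') => -[u' uc'] psi' /=.
move=> sA sA' /andP[d0 d1] AA'.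
have stab := energy_stability hLf hLc hL hk hcm Ak Ak' sA sA' AA'.
have [[[[Hu _] _] _] _ _ _] := sA; have [[[[Hu' _] _] _] _ _ _] := sA'.
have fU := fin_open_DDc Lf hL.
have HU v : H1 (D Lc L `|` Dc Lf Lc `|` Gammac Lc) v -> H1 (D Lc L `|` Dc Lf Lc) v.
  by apply: H1_VH => //; case: fU.
have := gap_perturbation fU (HU _ Hu) (HU _ Hu') d0.
move=> /le_trans; apply.
set e := fun p => _ in stab *.
have He : H1 (D Lc L `|` Dc Lf Lc) e by apply: H1_lin fU _ _; exact: HU.
have -> : dirichlet (D Lc L `|` Dc Lf Lc) e = dirichlet (D Lc L) e + dirichlet (Dc Lf Lc) e.
  apply: dirichlet_setU fU _ _ => //; [exact: fin_open_D|exact: fin_open_Dc|].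
  by move=> x [_ nc] [oc _]; apply: nc; exact: osquare_csquare.
rewrite [leRHS]mulrDr lerD2l.
apply: (perturbation_bound stab _ d0 d1 (energy_ge0 _ _ _ _)).
exact: add_le_double_half (dirichlet_ge0 _ _).
Qed.

Lemma cost_continuous :
  (forall A, admissible cm cp A ->
    is_coupled_solution Lf Lc L TH Th k A (solution A)) ->
  {within [set p | admissible cm cp (sym_mx p)], continuous (fun p => cost (sym_mx p))}.
Proof.
move=> sol; apply/subspace_continuousP => p Ap; apply/cvgrPdist_le => e e0.
pose M := cost (sym_mx p) + 16 / cm ^+ 2 * energy Lf Lc L (ubar Lf Lc L TH Th k (sym_mx p)).
have M0 : 0 <= M.
  rewrite addr_ge0//; first exact: gap_ge0.
  by rewrite mulr_ge0 ?energy_ge0 ?divr_ge0 ?exprn_ge0 ?ltW.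
(* The estimate asks for d <= 1, and M + 1 is positive even if M is 0. *)
pose d := Num.min 1 (e / (M + 1)).
have d0 : 0 < d by rewrite lt_min ltr01 divr_gt0// ltr_wpDl.
have dM : d * M <= e.
  apply: (@le_trans _ _ (d * (M + 1))); first by rewrite ler_wpM2l ?lerDl ?ltW.
  by rewrite -ler_pdivlMr ?ltr_wpDl// ge_min lexx orbT.
apply/nbhs_ballP; exists d => //= q pq Aq; rewrite distrC.
apply: le_trans dM; apply: cost_perturbation; try exact: sol; try by [].
- by rewrite d0 ge_min lexx.
- exact: sym_mx_dist.
Qed.

End Minimum.

Theorem theorem19 (R : realType) (Lf Lc L : R)
    (hLf : 0 < Lf) (hLc : Lf < Lc) (hL : Lc < L)
    (k : R -> R * R -> 'M[R]_2) (eps H h : R)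
    (heps : 0 < eps) (hH : 0 < H) (hh : 0 < h)
    (hk : coefficient (Omega L) (k eps))
    (TH Th : seq {ffun 'I_3 -> R * R})
    (hTH : mesh (D Lc L) (Dc Lf Lc) TH) (hTH_size : mesh_size TH = H)
    (hTh : mesh (Dc Lf Lc) (Df Lf) Th) (hTh_size : mesh_size Th = h)
    (hsub : submesh_in (Dc Lf Lc) Th TH)
    (cm cp : R) (hcm : 0 < cm) (hcp : cm < cp) :
  exists kopt : 'M[R]_2,
    minimizer (cost Lf Lc L TH Th (k eps)) (admissible cm cp) kopt.
Proof.
have Acm := scalar_admissible hcp.
(* The boundary and coupling constraints do not mention the matrix, so one case distinction serves
   all admissible matrices at once. *)
have [[[u0 c0] [Hu0 Hc0 orth]]|no] := pselect (exists z : (R * R -> R) * (R * R -> R),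
  [/\ VH_DirBC Lf Lc L TH z.1, Vh Lf Lc Th z.2 &
    forall phi, W_enrich Lf Lc TH Th phi -> C Lf Lc (fun x => z.1 x - z.2 x) phi = 0]).
- have sol A : admissible cm cp A -> is_coupled_solution Lf Lc L TH Th (k eps) A
      (coupled_solution Lf Lc L TH Th (k eps) A).
    move=> Ak; apply: (xgetPex (_, _, _)).
    exact: (coupled_solution_exists hLf hLc hL hk hTH hTh (ltW hcm) Ak Hu0 Hc0 orth).
  have [|p /set_mem Ap pmin] := compact_EVT_min _ (admissible_compact hcm)
    (cost_continuous hLf hLc hL hk hcm sol).
    exists (cm, (0, cm)); rewrite /= (_ : sym_mx _ = cm%:M)//.
    rewrite -[RHS]sym_mxK; last exact: tr_scalar_mx.
    by rewrite !mxE/= mulr1n mulr0n.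
  have Apm : admissible cm cp (sym_mx p) := Ap.
  exists (sym_mx p); apply: (minimizerP Apm) => A Ak.
  have sA : symmetric_mx A by case: Ak.
  have := pmin (A 0 0, (A 0 1, A 1 1)); rewrite (sym_mxK sA); apply.
  by apply/mem_set; rewrite /= sym_mxK.
exists cm%:M; apply: (minimizerP Acm) => A _; rewrite /cost /ubar.
have nosol B : coupled_solution Lf Lc L TH Th (k eps) B = (fun=> 0, fun=> 0, fun=> 0).
  apply: xgetPN => -[[u uc] psi] [[Hu [Huc _]] _ _ orth].
  by apply: no; exists (u, uc).
rewrite !nosol; exact: lexx.
Qed.
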